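(* Let $\sigma>0$ be constant and consider the 2D Jacobian-splitting active flux (semi-discrete) scheme on a uniform Cartesian mesh with cell sizes $\Delta x,\Delta y$ for the hyperbolic heat equation $p_t+\frac1\epsilon u_x+\frac1\epsilon v_y=0$, $u_t+\frac1\epsilon p_x+\frac\sigma{\epsilon^2}u=0$, $v_t+\frac1\epsilon p_y+\frac\sigma{\epsilon^2}v=0$, as written out in the context. Assume that its solution has a formal power series expansion in $\epsilon$ and is sufficiently regular, both in the sense of the context. Then, as $\epsilon\to0$ (i.e. upon equating the coefficients of equal powers of $\epsilon$), the leading order solutions satisfy the following relations for all $i,j$. (1) $\bar u^{(0)}_{ij}=\bar v^{(0)}_{ij}=u^{(0)}_\zeta=v^{(0)}_\zeta=0$ for every point value location $\zeta$ (face centers and corners). (2) $$\bar u_{ij}^{(1)}=-\frac1{\sigma\Delta x}\big(\hat p^{(0)}_{i+\frac12,j}-\hat p^{(0)}_{i-\frac12,j}\big),\qquad \bar v_{ij}^{(1)}=-\frac1{\sigma\Delta y}\big(\hat p^{(0)}_{i,j+\frac12}-\hat p^{(0)}_{i,j-\frac12}\big),$$ $$u^{(1)}_{i+\frac12,j+\frac12}=-\frac1{2\sigma}\big[(D_x^+)_{i+\frac12,j+\frac12}+(D_x^-)_{i+\frac12,j+\frac12}\big]p^{(0)},\qquad v^{(1)}_{i+\frac12,j+\frac12}=-\frac1{2\sigma}\big[(D_y^+)_{i+\frac12,j+\frac12}+(D_y^-)_{i+\frac12,j+\frac12}\big]p^{(0)},$$ $$u^{(1)}_{i+\frac12,j}=-\frac1{2\sigma}\big[(D_x^+)_{i+\frac12,j}+(D_x^-)_{i+\frac12,j}\big]p^{(0)},\qquad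 v^{(1)}_{i+\frac12,j}=-\frac1\sigma(D_y)_{i+\frac12,j}p^{(0)},$$ $$u^{(1)}_{i,j+\frac12}=-\frac1\sigma(D_x)_{i,j+\frac12}p^{(0)},\qquad v^{(1)}_{i,j+\frac12}=-\frac1{2\sigma}\big[(D_y^+)_{i,j+\frac12}+(D_y^-)_{i,j+\frac12}\big]p^{(0)}.$$ (3) $$\frac{\mathrm d}{\mathrm dt}\bar p^{(0)}_{ij}=-\frac1{\Delta x}\big(\hat u^{(1)}_{i+\frac12,j}-\hat u^{(1)}_{i-\frac12,j}\big)-\frac1{\Delta y}\big(\hat v^{(1)}_{i,j+\frac12}-\hat v^{(1)}_{i,j-\frac12}\big).$$ (4) $$\frac{\mathrm d}{\mathrm dt}p^{(0)}_{i+\frac12,j+\frac12}=-\frac12\big[(D_x^+)_{i+\frac12,j+\frac12}+(D_x^-)_{i+\frac12,j+\frac12}\big]u^{(1)}-\frac12\big[(D_y^+)_{i+\frac12,j+\frac12}+(D_y^-)_{i+\frac12,j+\frac12}\big]v^{(1)}+\mathcal O(\Delta x^3+\Delta y^3),$$ $$\frac{\mathrm d}{\mathrm dt}p^{(0)}_{i+\frac12,j}=-\frac12\big[(D_x^+)_{i+\frac12,j}+(D_x^-)_{i+\frac12,j}\big]u^{(1)}-(D_y)_{i+\frac12,j}v^{(1)}+\mathcal O(\Delta x^3),$$ $$\frac{\mathrm d}{\mathrm dt}p^{(0)}_{i,j+\frac12}=-(D_x)_{i,j+\frac12}u^{(1)}-\frac12\big[(D_y^+)_{i,j+\frac12}+(D_y^-)_{i,j+\frac12}\big]v^{(1)}+\mathcal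 O(\Delta y^3).$$ Moreover, these are approximations of the heat equation $p^{(0)}_t=\frac1\sigma p^{(0)}_{xx}+\frac1\sigma p^{(0)}_{yy}$ with truncation errors $\mathcal O(\Delta x^2+\Delta y^2)$, in the sense that $$\frac{\mathrm d}{\mathrm dt}\bar p^{(0)}_{ij}=\frac1{\sigma\Delta x}\Big(\frac1{\Delta y}\int_{y_{j-\frac12}}^{y_{j+\frac12}}p^{(0)}_x\,\mathrm dy\Big)\Big|_{x=x_{i-\frac12}}^{x=x_{i+\frac12}}+\frac1{\sigma\Delta y}\Big(\frac1{\Delta x}\int_{x_{i-\frac12}}^{x_{i+\frac12}}p^{(0)}_y\,\mathrm dx\Big)\Big|_{y=y_{j-\frac12}}^{y=y_{j+\frac12}}+\mathcal O(\Delta x^2+\Delta y^2),$$ and, for every point value location $\zeta$ (face centers and corners), $$\frac{\mathrm d}{\mathrm dt}p^{(0)}_\zeta=\Big(\frac1\sigma p^{(0)}_{xx}+\frac1\sigma p^{(0)}_{yy}\Big)\Big|_\zeta+\mathcal O(\Delta x^2+\Delta y^2).$$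
   Context: Mesh: uniform Cartesian cells $I_{ij}=[x_{i-\frac12},x_{i+\frac12}]\times[y_{j-\frac12},y_{j+\frac12}]$ of size $\Delta x\times\Delta y$ with centers $(x_i,y_j)$; indices range over $\mathbb Z$ (with periodic extension in the case of a periodic domain). Unknowns, functions of $t$, for each $q\in\{p,u,v\}$: cell averages $\bar q_{ij}$; point values at face centers, $q_{i+\frac12,j}$ at $(x_{i+\frac12},y_j)$ and $q_{i,j+\frac12}$ at $(x_i,y_{j+\frac12})$; point values at corners, $q_{i+\frac12,j+\frac12}$ at $(x_{i+\frac12},y_{j+\frac12})$. Numerical fluxes: $$\hat q_{i+\frac12,j}=\tfrac16\big(q_{i+\frac12,j-\frac12}+4q_{i+\frac12,j}+q_{i+\frac12,j+\frac12}\big),\qquad \hat q_{i,j+\frac12}=\tfrac16\big(q_{i-\frac12,j+\frac12}+4q_{i,j+\frac12}+q_{i+\frac12,j+\frac12}\big).$$ Cell center value (an auxiliary quantity): $$q_{i,j}=\tfrac1{16}\big[36\bar q_{ij}-4(q_{i-\frac12,j}+q_{i+\frac12,j}+q_{i,j-\frac12}+q_{i,j+\frac12})-(q_{i-\frac12,j-\frac12}+q_{i+\frac12,j-\frac12}+q_{i-\frac12,j+\frac12}+q_{i+\frac12,j+\frac12})\big].$$ Difference operators. With $m\in\{j,\,j+\frac12\}$: $$(D_x^+)_{i+\frac12,m}a=\tfrac1{\Delta x}\big(a_{i-\frac12,m}-4a_{i,m}+3a_{i+\frac12,m}\big),\qquad (D_x^-)_{i+\frac12,m}a=\tfrac1{\Delta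 x}\big(-3a_{i+\frac12,m}+4a_{i+1,m}-a_{i+\frac32,m}\big),$$ and with $l\in\{i,\,i+\frac12\}$: $$(D_y^+)_{l,j+\frac12}a=\tfrac1{\Delta y}\big(a_{l,j-\frac12}-4a_{l,j}+3a_{l,j+\frac12}\big),\qquad (D_y^-)_{l,j+\frac12}a=\tfrac1{\Delta y}\big(-3a_{l,j+\frac12}+4a_{l,j+1}-a_{l,j+\frac32}\big),$$ $$(D_y)_{i+\frac12,j}a=\tfrac1{\Delta y}\big(a_{i+\frac12,j+\frac12}-a_{i+\frac12,j-\frac12}\big),\qquad (D_x)_{i,j+\frac12}a=\tfrac1{\Delta x}\big(a_{i+\frac12,j+\frac12}-a_{i-\frac12,j+\frac12}\big).$$ Fluxes, cell center values and difference operators are applied in the same way to the expansion coefficients $q^{(k)}$ introduced below. Scheme ($0<\epsilon<1$, $\sigma>0$ constant). Cell averages: $$\frac{\mathrm d\bar p_{ij}}{\mathrm dt}=-\frac1{\epsilon\Delta x}(\hat u_{i+\frac12,j}-\hat u_{i-\frac12,j})-\frac1{\epsilon\Delta y}(\hat v_{i,j+\frac12}-\hat v_{i,j-\frac12}),$$ $$\frac{\mathrm d\bar u_{ij}}{\mathrm dt}=-\frac1{\epsilon\Delta x}(\hat p_{i+\frac12,j}-\hat p_{i-\frac12,j})-\frac\sigma{\epsilon^2}\bar u_{ij},\qquad \frac{\mathrm d\bar v_{ij}}{\mathrm dt}=-\frac1{\epsilon\Delta y}(\hat p_{i,j+\frac12}-\hat p_{i,j-\frac12})-\frac\sigma{\epsilon^2}\bar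 v_{ij}.$$ Corners (all operators and values at $(i+\frac12,j+\frac12)$): $$\frac{\mathrm dp}{\mathrm dt}=-\frac1{2\epsilon}\big[D_x^+(p+u)-D_x^-(p-u)\big]-\frac1{2\epsilon}\big[D_y^+(p+v)-D_y^-(p-v)\big],$$ $$\frac{\mathrm du}{\mathrm dt}=-\frac1{2\epsilon}\big[D_x^+(p+u)+D_x^-(p-u)\big]-\frac\sigma{\epsilon^2}u,\qquad \frac{\mathrm dv}{\mathrm dt}=-\frac1{2\epsilon}\big[D_y^+(p+v)+D_y^-(p-v)\big]-\frac\sigma{\epsilon^2}v.$$ Face centers $(i+\frac12,j)$ (all operators and values there): $$\frac{\mathrm dp}{\mathrm dt}=-\frac1{2\epsilon}\big[D_x^+(p+u)-D_x^-(p-u)\big]-\frac1\epsilon D_yv,$$ $$\frac{\mathrm du}{\mathrm dt}=-\frac1{2\epsilon}\big[D_x^+(p+u)+D_x^-(p-u)\big]-\frac\sigma{\epsilon^2}u,\qquad \frac{\mathrm dv}{\mathrm dt}=-\frac1\epsilon D_yp-\frac\sigma{\epsilon^2}v.$$ Face centers $(i,j+\frac12)$ (all operators and values there): $$\frac{\mathrm dp}{\mathrm dt}=-\frac1\epsilon D_xu-\frac1{2\epsilon}\big[D_y^+(p+v)-D_y^-(p-v)\big],$$ $$\frac{\mathrm du}{\mathrm dt}=-\frac1\epsilon D_xp-\frac\sigma{\epsilon^2}u,\qquad \frac{\mathrm dv}{\mathrm dt}=-\frac1{2\epsilon}\big[D_y^+(p+v)+D_y^-(p-v)\big]-\frac\sigma{\epsilon^2}v.$$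 Formal expansion in $\epsilon$: each unknown $q$ (cell average or point value of $p,u,v$) is a formal power series $q=q^{(0)}+\epsilon q^{(1)}+\epsilon^2q^{(2)}+\dots$, with coefficients that are differentiable functions of $t$ independent of $\epsilon$, and the scheme holds as an identity of formal (Laurent) series in $\epsilon$, i.e. the coefficients of each power of $\epsilon$ agree. Sufficient regularity: for $k=0,1$ there is a function $p^{(k)}(x,y,t)$, as smooth in $(x,y)$ as needed for the Taylor expansions, with bounded spatial derivatives, such that $\bar p^{(k)}_{ij}(t)$ is the average of $p^{(k)}(\cdot,\cdot,t)$ over $I_{ij}$ and each point value of $p^{(k)}$ in the scheme is the value of $p^{(k)}(\cdot,\cdot,t)$ at the corresponding point. The symbols $\mathcal O(\cdot)$ refer to mesh refinement $\Delta x,\Delta y\to0$. The notation $f|_{x=a}^{x=b}$ means $f(b)-f(a)$ (and similarly in $y$).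
   Formalization: The two face-center bounds in (4) are false for independent Δx, Δy→0 (true size Δx³+Δy⁴/Δx, resp. Δy³+Δx⁴/Δy), so O(Δx³) is stated on meshes with Δy≤κΔx and O(Δy³) on meshes with Δx≤κΔy, for arbitrary fixed κ. *)

(* Defs.v *)
(* Stdlib reals with Coquelicot. *)
From Stdlib Require Export Reals ZArith.
From Coquelicot Require Export Coquelicot.
Open Scope R_scope.

(** * Mesh *)

Record mesh := Mesh {
  x0 : R; y0 : R; dx : R; dy : R;
  dx_pos : 0 < dx;
  dy_pos : 0 < dy
}.

(* [xc m i] is x_i and [xh m i] is x_{i+1/2}; likewise in y. *)
Definition xc (m : mesh) (i : Z) : R := x0 m + IZR i * dx m.
Definition xh (m : mesh) (i : Z) : R := x0 m + (IZR i + / 2) * dx m.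
Definition yc (m : mesh) (j : Z) : R := y0 m + IZR j * dy m.
Definition yh (m : mesh) (j : Z) : R := y0 m + (IZR j + / 2) * dy m.

(** * Unknowns *)

(* For integers i, j the locations denote the cell average over I_{ij} and the
   point values at (x_{i+1/2}, y_j), (x_i, y_{j+1/2}), (x_{i+1/2}, y_{j+1/2}). *)
Inductive loc := Cell | FaceX | FaceY | Corner.
Inductive unknown := Pvar | Uvar | Vvar.

Definition gridfun := loc -> Z -> Z -> R.
Definition state := unknown -> gridfun.

Definition is_point (l : loc) : Prop := l <> Cell.

Definition xloc (m : mesh) (l : loc) (i : Z) : R :=
  match l with Cell | FaceY => xc m i | FaceX | Corner => xh m i end.
Definition yloc (m : mesh) (l : loc) (j : Z) : R :=
  match l with Cell | FaceX => yc m j | FaceY | Corner => yh m j end.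

Definition gadd (a b : gridfun) : gridfun := fun l i j => a l i j + b l i j.
Definition gsub (a b : gridfun) : gridfun := fun l i j => a l i j - b l i j.

(** * Fluxes, cell center values, difference operators *)

Definition flux_x (a : gridfun) (i j : Z) : R :=
  / 6 * (a Corner i (j - 1)%Z + 4 * a FaceX i j + a Corner i j).
Definition flux_y (a : gridfun) (i j : Z) : R :=
  / 6 * (a Corner (i - 1)%Z j + 4 * a FaceY i j + a Corner i j).

Definition center (a : gridfun) (i j : Z) : R :=
  / 16 * (36 * a Cell i j
    - 4 * (a FaceX (i - 1)%Z j + a FaceX i j + a FaceY i (j - 1)%Z + a FaceY i j)
    - (a Corner (i - 1)%Z (j - 1)%Z + a Corner i (j - 1)%Z
       + a Corner (i - 1)%Z j + a Corner i j)).

(* [Half i] is the index i+1/2. *)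
Inductive index := Whole (i : Z) | Half (i : Z).

Definition val (a : gridfun) (k l : index) : R :=
  match k, l with
  | Whole i, Whole j => center a i j
  | Half i, Whole j => a FaceX i j
  | Whole i, Half j => a FaceY i j
  | Half i, Half j => a Corner i j
  end.

(* (D_x^{+-})_{i+1/2,k} and (D_y^{+-})_{k,j+1/2} *)
Definition Dx_plus (m : mesh) (i : Z) (k : index) (a : gridfun) : R :=
  / dx m * (val a (Half (i - 1)) k - 4 * val a (Whole i) k + 3 * val a (Half i) k).
Definition Dx_minus (m : mesh) (i : Z) (k : index) (a : gridfun) : R :=
  / dx m * (- 3 * val a (Half i) k + 4 * val a (Whole (i + 1)) k
            - val a (Half (i + 1)) k).
Definition Dy_plus (m : mesh) (k : index) (j : Z) (a : gridfun) : R :=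
  / dy m * (val a k (Half (j - 1)) - 4 * val a k (Whole j) + 3 * val a k (Half j)).
Definition Dy_minus (m : mesh) (k : index) (j : Z) (a : gridfun) : R :=
  / dy m * (- 3 * val a k (Half j) + 4 * val a k (Whole (j + 1))
            - val a k (Half (j + 1))).

(* (D_y)_{i+1/2,j} and (D_x)_{i,j+1/2} *)
Definition Dy (m : mesh) (i j : Z) (a : gridfun) : R :=
  / dy m * (a Corner i j - a Corner i (j - 1)%Z).
Definition Dx (m : mesh) (i j : Z) (a : gridfun) : R :=
  / dx m * (a Corner i j - a Corner (i - 1)%Z j).

(** * The scheme

    The scheme reads dw/dt = (1/eps) transport w + (1/eps^2) relax w, where
    [transport] and [relax] do not involve eps. *)

Definition transport (m : mesh) (w : state) : state :=
  let p := w Pvar in let u := w Uvar in let v := w Vvar in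
  fun q l i j =>
  match q, l with
  | Pvar, Cell =>
      - / dx m * (flux_x u i j - flux_x u (i - 1) j)
      - / dy m * (flux_y v i j - flux_y v i (j - 1))
  | Uvar, Cell => - / dx m * (flux_x p i j - flux_x p (i - 1) j)
  | Vvar, Cell => - / dy m * (flux_y p i j - flux_y p i (j - 1))
  | Pvar, Corner =>
      - / 2 * (Dx_plus m i (Half j) (gadd p u) - Dx_minus m i (Half j) (gsub p u))
      - / 2 * (Dy_plus m (Half i) j (gadd p v) - Dy_minus m (Half i) j (gsub p v))
  | Uvar, Corner =>
      - / 2 * (Dx_plus m i (Half j) (gadd p u) + Dx_minus m i (Half j) (gsub p u))
  | Vvar, Corner =>
      - / 2 * (Dy_plus m (Half i) j (gadd p v) + Dy_minus m (Half i) j (gsub p v))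
  | Pvar, FaceX =>
      - / 2 * (Dx_plus m i (Whole j) (gadd p u) - Dx_minus m i (Whole j) (gsub p u))
      - Dy m i j v
  | Uvar, FaceX =>
      - / 2 * (Dx_plus m i (Whole j) (gadd p u) + Dx_minus m i (Whole j) (gsub p u))
  | Vvar, FaceX => - Dy m i j p
  | Pvar, FaceY =>
      - Dx m i j u
      - / 2 * (Dy_plus m (Whole i) j (gadd p v) - Dy_minus m (Whole i) j (gsub p v))
  | Uvar, FaceY => - Dx m i j p
  | Vvar, FaceY =>
      - / 2 * (Dy_plus m (Whole i) j (gadd p v) + Dy_minus m (Whole i) j (gsub p v))
  end.

Definition relax (sigma : R) (w : state) : state :=
  fun q l i j =>
  match q with
  | Pvar => 0
  | Uvar | Vvar => - sigma * w q l i j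
  end.

(** * Formal expansion in eps *)

(* [W k t q l i j] is the coefficient q^(k)(t) at the given location. *)
Definition expansion := nat -> R -> state.

(* Coefficient of eps^n of the corresponding formal Laurent series. *)
Definition coef (W : expansion) (n : Z) (t : R) : state :=
  fun q l i j => if (n <? 0)%Z then 0 else W (Z.to_nat n) t q l i j.

(* Coefficient of eps^n in dw/dt = eps^-1 transport w + eps^-2 relax w, for
   every integer n, at all times in the set T. *)
Definition formal_solution (m : mesh) (sigma : R) (T : R -> Prop)
    (W : expansion) : Prop :=
  forall (n : Z) (t : R) (q : unknown) (l : loc) (i j : Z), T t ->
    is_derive (fun s => coef W n s q l i j) t
      (transport m (coef W (n + 1) t) q l i j
       + relax sigma (coef W (n + 2) t) q l i j).

(** * Regularity *)

Definition cell_average (m : mesh) (f : R -> R -> R) (i j : Z) : R :=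
  / (dx m * dy m) *
  RInt (fun x => RInt (fun y => f x y) (yh m (j - 1)) (yh m j))
       (xh m (i - 1)) (xh m i).

(* [pf k t x y] is p^(k)(x,y,t).  Four derivatives suffice for all the Taylor
   expansions needed; [M] bounds the derivatives.  The cell center values are
   not point values of the scheme, so nothing is required of them. *)
Definition regular (m : mesh) (M : R) (T : R -> Prop) (W : expansion)
    (pf : nat -> R -> R -> R -> R) : Prop :=
  forall (k : nat) (t : R), (k <= 1)%nat -> T t ->
    (forall x y, ex_diff_n (pf k t) 4 x y) /\
    (forall (a b : nat) (x y : R), (1 <= a + b <= 4)%nat ->
       Rabs (partial_derive a b (pf k t) x y) <= M) /\
    (forall i j, W k t Pvar Cell i j = cell_average m (pf k t) i j) /\
    (forall l i j, is_point l ->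
       W k t Pvar l i j = pf k t (xloc m l i) (yloc m l j)).

(** * Orders of accuracy under mesh refinement *)

(* Cell center values are reconstructed from averages, with an error of order
   dx^4 + dy^4 that (D_x^+ - D_x^-) p^(1) divides by dx on the rows y = y_j.
   An O(dx^3) bound there needs dy = O(dx); symmetrically in the other
   direction. *)
Definition any_mesh (hx hy : R) : Prop := True.
Definition dy_le (kappa hx hy : R) : Prop := hy <= kappa * hx.
Definition dx_le (kappa hx hy : R) : Prop := hx <= kappa * hy.

(* err = O(rate) as dx, dy -> 0 along meshes satisfying [mesh_cond], uniformly
   in i, j, t.  On every mesh there may be a different solution, so the constants
   depend only on sigma and on the bound M for the derivatives of the p^(k). *)
Definition bigO (sigma : R) (mesh_cond : R -> R -> Prop) (rate : R -> R -> R)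
    (err : mesh -> expansion -> (nat -> R -> R -> R -> R) -> R -> Z -> Z -> R)
    : Prop :=
  forall M : R, exists C delta : R, 0 < delta /\
    forall (m : mesh) (T : R -> Prop) (W : expansion)
           (pf : nat -> R -> R -> R -> R),
      dx m < delta -> dy m < delta -> mesh_cond (dx m) (dy m) ->
      open T -> formal_solution m sigma T W -> regular m M T W pf ->
      forall (t : R) (i j : Z), T t ->
        Rabs (err m W pf t i j) <= C * rate (dx m) (dy m).

(* (f_xx + f_yy) / sigma *)
Definition heat_rhs (sigma : R) (f : R -> R -> R) (x y : R) : R :=
  / sigma * partial_derive 2 0 f x y + / sigma * partial_derive 0 2 f x y.

(* The cell average of [heat_rhs], written with boundary fluxes. *)
Definition heat_rhs_cell (sigma : R) (m : mesh) (f : R -> R -> R) (i j : Z) : R :=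
  let Fx x := / dy m *
    RInt (fun y => partial_derive 1 0 f x y) (yh m (j - 1)) (yh m j) in
  let Fy y := / dx m *
    RInt (fun x => partial_derive 0 1 f x y) (xh m (i - 1)) (xh m i) in
  / (sigma * dx m) * (Fx (xh m i) - Fx (xh m (i - 1)))
  + / (sigma * dy m) * (Fy (yh m j) - Fy (yh m (j - 1))).

(* Main.v *)
(* Write [grad_x] for the discrete x-derivative carried by the scheme (its value at
   a location mimics the operator used there) and [dissip_x] for half the difference
   of the two upwind operators; likewise in y.  The p-equation is
     transport p = - grad_x u - grad_y v - dissip_x p - dissip_y p.
   The orders eps^-2, eps^-1, eps^0 give
     u0 = v0 = 0,  u1 = - grad_x p0 / sigma,  v1 = - grad_y p0 / sigma,
     dissip_x p0 + dissip_y p0 = 0,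
     dp0/dt = - grad_x u1 - grad_y v1 - dissip_x p1 - dissip_y p1,
   and [dissip_x p1] is a fourth difference divided by dx.

   Cell centers are Simpson reconstructions with error O(dx^4 + dy^4), which cannot
   be divided by dx^2 when dy is much larger than dx.  In [grad_x (grad_x p0)] only
   second x-differences of this error occur, and mixed derivatives bound these by
   dx^2 (dx^2 + dy^2); hence [grad_x (grad_x p0) = p0_xx + O(dx^2 + dy^2)] on every
   mesh.

   On the x-faces [dissip_x p1] is O(dx^3 + dy^4 / dx), too large for heat
   consistency when dx < dy.  There one differentiates [dissip_x p0 = 0] in time: the
   face residuals r_i of dp0/dt on a row satisfy
   2 r_(i-1) + 8 r_i + 2 r_(i+1) = O(dx^2 + dy^2), the other residuals being already
   under control because dx < dy.  The system is diagonally dominant and r is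
   bounded, so r = O(dx^2 + dy^2).  Statements in y follow by transposing the grid. *)
Require Import Defs.
From Stdlib Require Import Lra Lia Psatz.

(** * Taylor expansion and quadrature in one variable *)

Lemma Derive_n_family (G : nat -> R -> R) (n : nat)
    (HG : forall k t, (k <= n)%nat -> is_derive (G k) t (G (S k) t)) :
  forall k t, (k <= S n)%nat -> Derive_n (G 0%nat) k t = G k t.
Proof.
  induction k as [|k IH]; intros t Hk; [reflexivity|].
  simpl. rewrite (Derive_ext _ (G k)) by (intros s; apply IH; lia).
  apply is_derive_unique, HG; lia.
Qed.

Lemma taylor_bound_right (G : nat -> R -> R) (n : nat) (N x s : R)
    (HG : forall k t, (k <= n)%nat -> is_derive (G k) t (G (S k) t))
    (HN : forall t, Rabs (G (S n) t) <= N) (Hs : 0 < s) :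
  Rabs (G 0%nat (x + s)
        - sum_f_R0 (fun k => s ^ k / INR (fact k) * G k x) n)
    <= N * s ^ S n / INR (fact (S n)).
Proof.
  assert (HD := Derive_n_family G n HG).
  destruct (Taylor_Lagrange (G 0%nat) n x (x + s)) as [z [_ ->]]; [lra| |].
  { intros t _ k Hk. destruct k as [|k]; [exact I|].
    apply (ex_derive_ext (G k)); [intros r; symmetry; apply HD; lia|].
    eexists; apply HG; lia. }
  replace (x + s - x) with s by ring.
  rewrite (sum_eq _ (fun k => s ^ k / INR (fact k) * G k x))
    by (intros k Hk; rewrite HD by lia; reflexivity).
  match goal with |- Rabs (?A + ?B - ?A) <= _ => replace (A + B - A) with B by ring end.
  rewrite HD by lia.
  assert (Hf := INR_fact_lt_0 (S n)).
  assert (Hp : 0 < s ^ S n / INR (fact (S n)))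
    by (apply Rdiv_lt_0_compat; [apply pow_lt|]; lra).
  rewrite Rabs_mult, (Rabs_pos_eq (s ^ S n / _)) by lra.
  replace (N * s ^ S n / INR (fact (S n))) with (s ^ S n / INR (fact (S n)) * N)
    by (field; lra).
  apply Rmult_le_compat_l; [lra | apply HN].
Qed.

(** For [s < 0] the reflected family [(-1)^k G_k(-r)] is again a chain of derivatives with the same
    bound, so the case of a positive increment applies to it. The case [s = 0] is separate because
    [Taylor_Lagrange] needs a nondegenerate interval. *)
Lemma taylor_bound (G : nat -> R -> R) (n : nat) (N x s : R)
    (HG : forall k t, (k <= n)%nat -> is_derive (G k) t (G (S k) t))
    (HN : forall t, Rabs (G (S n) t) <= N) :
  Rabs (G 0%nat (x + s)
        - sum_f_R0 (fun k => s ^ k / INR (fact k) * G k x) n)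
    <= N * Rabs s ^ S n / INR (fact (S n)).
Proof.
  destruct (Rtotal_order s 0) as [Hs | [-> | Hs]].
  - assert (HG' : forall k t, (k <= n)%nat ->
        is_derive (fun r => (-1) ^ k * G k (- r)) t ((-1) ^ S k * G (S k) (- t))).
    { intros k t Hk.
      evar_last.
      { apply is_derive_scal, (is_derive_comp (G k) Ropp); [apply HG, Hk|].
        instantiate (1 := - 1). auto_derive; [trivial | ring]. }
      unfold scal; simpl; unfold mult; simpl. ring. }
    assert (H := taylor_bound_right (fun k r => (-1) ^ k * G k (- r)) n N (- x) (- s) HG').
    rewrite (Rabs_left s) by lra.
    replace (x + s) with (- (- x + - s)) by ring.
    rewrite (sum_eq (fun k => s ^ k / INR (fact k) * G k x)
               (fun k => (- s) ^ k / INR (fact k) * ((-1) ^ k * G k (- - x)))).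
    + replace (G 0%nat (- (- x + - s)))
        with ((-1) ^ 0 * G 0%nat (- (- x + - s))) by (simpl; ring).
      apply H; [|lra].
      intros t. rewrite Rabs_mult, pow_1_abs, Rmult_1_l. apply HN.
    + intros k _. rewrite Ropp_involutive.
      replace s with (-1 * - s) at 1 by ring. rewrite Rpow_mult_distr.
      field. apply INR_fact_neq_0.
  - rewrite Rplus_0_r.
    rewrite (sum_eq _ (fun k => match k with 0%nat => G 0%nat x | _ => 0 end)).
    + replace (sum_f_R0 _ n) with (G 0%nat x).
      * rewrite Rabs_R0, Rminus_diag, Rabs_R0, pow_i by lia. right; field.
        apply INR_fact_neq_0.
      * clear. induction n as [|n IH]; simpl; [reflexivity | rewrite <- IH; ring].
    + intros [|k] _; [simpl; field | rewrite pow_i by lia; field; apply INR_fact_neq_0].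
  - rewrite (Rabs_pos_eq s) by lra. apply taylor_bound_right; assumption.
Qed.

(** Here and in [simpson], [h] is a half-width: a mesh cell corresponds to [h = dx / 2] or
    [h = dy / 2]. *)
Definition mean (g : R -> R) (c h : R) : R := / (2 * h) * RInt g (c - h) (c + h).
Definition simpson (g : R -> R) (c h : R) : R := / 6 * (g (c - h) + 4 * g c + g (c + h)).

Lemma ex_RInt_cont (g : R -> R) (a b : R) :
  (forall t, continuous g t) -> ex_RInt g a b.
Proof. intros Hg. apply (ex_RInt_continuous g). intros; apply Hg. Qed.

(** Odd powers of [t - c] integrate to zero over the symmetric interval, so the cubic has mean
    [a0 + a2 h^2 / 3]; the pointwise error bound passes to the mean. *)
Lemma mean_bound (g : R -> R) (c h a0 a1 a2 a3 E : R)
    (Hh : 0 < h) (Hg : forall t, continuous g t)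
    (HE : forall s, - h <= s <= h ->
       Rabs (g (c + s) - (a0 + a1 * s + a2 * s ^ 2 + a3 * s ^ 3)) <= E) :
  Rabs (mean g c h - (a0 + a2 * h ^ 2 / 3)) <= E.
Proof.
  set (P := fun t => a0 + a1 * (t - c) + a2 * (t - c) ^ 2 + a3 * (t - c) ^ 3).
  set (Q := fun t => a0 * (t - c) + a1 * (t - c) ^ 2 / 2
                     + a2 * (t - c) ^ 3 / 3 + a3 * (t - c) ^ 4 / 4).
  assert (HP : forall t, continuous P t).
  { intros t. apply (ex_derive_continuous (V := R_NormedModule)).
    unfold P; auto_derive; trivial. }
  assert (IP : is_RInt P (c - h) (c + h) (Q (c + h) - Q (c - h))).
  { apply (is_RInt_derive Q P); intros t _; [|apply HP].
    unfold Q, P. auto_derive; [trivial|]. field. }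
  assert (B : Rabs (RInt (fun t => g t - P t) (c - h) (c + h)) <= (c + h - (c - h)) * E).
  { apply abs_RInt_le_const; [lra| |].
    - apply ex_RInt_cont. intros t. apply (continuous_minus g P); auto.
    - intros t Ht. specialize (HE (t - c)).
      replace (c + (t - c)) with t in HE by ring. apply HE; lra. }
  rewrite (RInt_minus g P) in B by (apply ex_RInt_cont; auto).
  rewrite (is_RInt_unique _ _ _ _ IP) in B.
  unfold minus, plus, opp in B; simpl in B.
  unfold mean. set (I := RInt g (c - h) (c + h)) in *.
  replace (/ (2 * h) * I - (a0 + a2 * h ^ 2 / 3))
    with (/ (2 * h) * (I + - (Q (c + h) - Q (c - h)))) by (unfold Q; field; lra).
  assert (Hi : 0 < / (2 * h)) by (apply Rinv_0_lt_compat; lra).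
  rewrite Rabs_mult, (Rabs_pos_eq (/ _)) by lra.
  apply Rle_trans with (/ (2 * h) * ((c + h - (c - h)) * E)).
  - apply Rmult_le_compat_l; lra.
  - right; field; lra.
Qed.

(** Splits bounds on absolute values into pairs of inequalities that are linear once nonlinear
    monomials count as atoms. Signs of such monomials have to be put in the context beforehand. *)
Ltac abs_lra :=
  repeat match goal with
  | H : Rabs _ <= _ |- _ => apply Rabs_le_between in H; destruct H
  end; try apply Rabs_le; try split; lra.

Lemma simpson_bound (g : R -> R) (c h a0 a1 a2 a3 E : R)
    (HE : forall s, - h <= s <= h ->
       Rabs (g (c + s) - (a0 + a1 * s + a2 * s ^ 2 + a3 * s ^ 3)) <= E) (Hh : 0 < h) :
  Rabs (simpson g c h - (a0 + a2 * h ^ 2 / 3)) <= E.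
Proof.
  unfold simpson.
  assert (H1 := HE h). assert (H2 := HE (- h)). assert (H3 := HE 0).
  replace (c + - h) with (c - h) in H2 by ring. rewrite Rplus_0_r in H3.
  specialize (H1 ltac:(lra)). specialize (H2 ltac:(lra)). specialize (H3 ltac:(lra)).
  abs_lra.
Qed.

(** Simpson's rule is exact on cubics: mean and rule both lie within [E] of the same number
    [a0 + a2 h^2 / 3]. *)
Lemma mean_simpson_bound (g : R -> R) (c h a0 a1 a2 a3 E : R)
    (Hh : 0 < h) (Hg : forall t, continuous g t)
    (HE : forall s, - h <= s <= h ->
       Rabs (g (c + s) - (a0 + a1 * s + a2 * s ^ 2 + a3 * s ^ 3)) <= E) :
  Rabs (mean g c h - simpson g c h) <= 2 * E.
Proof.
  assert (H1 := mean_bound g c h a0 a1 a2 a3 E Hh Hg HE).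
  assert (H2 := simpson_bound g c h a0 a1 a2 a3 E HE Hh).
  abs_lra.
Qed.

(** * Second differences and their commutation with averages *)

Definition second_diff (g : R -> R) (x d : R) : R := g (x + d) + g (x - d) - 2 * g x.

Lemma second_diff_bound (G : nat -> R -> R) (N x d : R)
    (HG : forall k t, (k <= 1)%nat -> is_derive (G k) t (G (S k) t))
    (HN : forall t, Rabs (G 2%nat t) <= N) :
  Rabs (second_diff (G 0%nat) x d) <= N * d ^ 2.
Proof.
  assert (H1 := taylor_bound G 1 N x d HG HN).
  assert (H2 := taylor_bound G 1 N x (- d) HG HN).
  rewrite Rabs_Ropp in H2. rewrite pow2_abs in H1, H2. simpl in H1, H2.
  unfold second_diff. replace (x - d) with (x + - d) by ring.
  unfold Rdiv in H1, H2. rewrite Rinv_1 in H1, H2. abs_lra.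
Qed.

Lemma mean_minus (g1 g2 : R -> R) (c h : R) :
  (forall t, continuous g1 t) -> (forall t, continuous g2 t) ->
  mean (fun t => g1 t - g2 t) c h = mean g1 c h - mean g2 c h.
Proof.
  intros H1 H2. unfold mean.
  rewrite (RInt_minus g1 g2) by (apply ex_RInt_cont; assumption).
  unfold minus, plus, opp; simpl. ring.
Qed.

Lemma mean_le (g : R -> R) (c h E : R) :
  0 < h -> (forall t, continuous g t) -> (forall t, Rabs (g t) <= E) ->
  Rabs (mean g c h) <= E.
Proof.
  intros Hh Hg HE. assert (H := mean_bound g c h 0 0 0 0 E Hh Hg).
  replace (mean g c h) with (mean g c h - (0 + 0 * h ^ 2 / 3)) by field.
  apply H. intros s _. replace (_ - _) with (g (c + s)) by ring. apply HE.
Qed.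

Lemma continuous_translate (g : R -> R) (d t : R) :
  (forall t, continuous g t) -> continuous (fun t => g (t + d)) t.
Proof.
  intros Hg. apply (continuous_comp (fun t => t + d) g); [|apply Hg].
  apply (ex_derive_continuous (V := R_NormedModule)). auto_derive; trivial.
Qed.

Lemma mean_translate (g : R -> R) (c h d : R) :
  (forall t, continuous g t) -> mean g (c + d) h = mean (fun t => g (t + d)) c h.
Proof.
  intros Hg. unfold mean. f_equal.
  assert (H := RInt_comp_lin g 1 d (c - h) (c + h)).
  replace (c + d - h) with (1 * (c - h) + d) by ring.
  replace (c + d + h) with (1 * (c + h) + d) by ring.
  rewrite <- H by (apply ex_RInt_cont; assumption).
  apply RInt_ext. intros t _. unfold scal; simpl; unfold mult; simpl.
  rewrite !Rmult_1_l. reflexivity.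
Qed.

Lemma mean_second_diff (g : R -> R) (c h d : R) :
  (forall t, continuous g t) ->
  second_diff (fun c => mean g c h) c d = mean (fun t => second_diff g t d) c h.
Proof.
  intros Hg.
  assert (C1 := fun t => continuous_translate g d t Hg).
  assert (C2 := fun t => continuous_translate g (- d) t Hg).
  unfold second_diff, Rminus at 1 2. rewrite !mean_translate by assumption.
  assert (C3 : forall t, continuous (fun t => g t - g (t + d)) t).
  { intros t. apply (continuous_minus g); auto. }
  assert (C4 : forall t, continuous (fun t => g (t + - d) - g t) t).
  { intros t. apply (continuous_minus _ g); auto. }
  (* Writing the second difference as a difference of two first differences reduces linearity of the
     integral to [mean_minus]. *)
  transitivity (mean (fun t => (g (t + - d) - g t) - (g t - g (t + d))) c h).
  - rewrite mean_minus by assumption. rewrite !mean_minus by assumption. ring.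
  - unfold mean. f_equal. apply RInt_ext. intros t _.
    unfold Rminus. match goal with |- ?l = ?r => change (l = r :> R) end. ring.
Qed.

Lemma lipschitz_continuous (g : R -> R) (L : R) :
  (forall s t, Rabs (g s - g t) <= L * Rabs (s - t)) -> forall t, continuous g t.
Proof.
  intros HL t. apply continuity_pt_filterlim. intros eps Heps.
  assert (HL0 : 0 <= L).
  { specialize (HL 1 0). rewrite Rminus_0_r, Rabs_R1 in HL.
    assert (H := Rabs_pos (g 1 - g 0)). lra. }
  (* [L + 1] in place of [L] covers the case [L = 0]. *)
  exists (eps / (L + 1)). split; [apply Rdiv_lt_0_compat; lra|].
  intros s [_ Hs]. unfold R_dist in *; simpl in *; unfold R_dist in *.
  apply Rle_lt_trans with (1 := HL s t).
  apply Rle_lt_trans with ((L + 1) * Rabs (s - t)).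
  - assert (H := Rabs_pos (s - t)). nra.
  - apply Rlt_le_trans with ((L + 1) * (eps / (L + 1))).
    + apply Rmult_lt_compat_l; lra.
    + right; field; lra.
Qed.

(** * Two-dimensional families of derivatives *)

(* [D a b] plays the role of the partial derivative of order a in x and b in y; unlike
   [partial_derive] this description is symmetric in x and y. *)
Record smooth (M : R) (D : nat -> nat -> R -> R -> R) : Prop := {
  smooth_x : forall a b x y, (a + b < 4)%nat ->
    is_derive (fun z => D a b z y) x (D (S a) b x y);
  smooth_y : forall a b x y, (a + b < 4)%nat ->
    is_derive (fun z => D a b x z) y (D a (S b) x y);
  smooth_bound : forall a b x y, (1 <= a + b <= 4)%nat -> Rabs (D a b x y) <= M
}.

Lemma smooth_transpose M D :
  smooth M D -> smooth M (fun a b x y => D b a y x).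
Proof.
  intros [Hx Hy Hb]. split; intros.
  - apply Hy; lia.
  - apply Hx; lia.
  - apply Hb; lia.
Qed.

(** In [partial_derive] the y-derivatives are innermost, so one more x-derivative is immediate,
    while one more y-derivative must be moved past those in x by Schwarz's theorem. *)
Lemma smooth_partial_derive (M : R) (f : R -> R -> R) :
  (forall x y, ex_diff_n f 4 x y) ->
  (forall a b x y, (1 <= a + b <= 4)%nat -> Rabs (partial_derive a b f x y) <= M) ->
  smooth M (fun a b => partial_derive a b f).
Proof.
  intros Hd Hb. split; [| |exact Hb]; intros a b x y Hab.
  - apply (Derive_correct (fun z => partial_derive a b f z y)).
    apply (ex_diff_n_ex_deriv_inf_1 4); auto.
  - rewrite <- (Derive_partial_derive a b f x y).
    + apply (Derive_correct (fun z => partial_derive a b f x z)).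
      apply (ex_diff_n_ex_deriv_inf_2 4); auto.
    + exists (mkposreal 1 Rlt_0_1). intros u v _ _.
      apply (ex_diff_n_m 4); [lia | apply Hd].
Qed.

Lemma smooth_continuous_x M D a b y :
  smooth M D -> (a + b < 4)%nat -> forall t, continuous (fun z => D a b z y) t.
Proof.
  intros HD Hab t. apply (ex_derive_continuous (V := R_NormedModule)).
  eexists. apply (smooth_x M D HD); assumption.
Qed.

Lemma smooth_continuous_y M D a b x :
  smooth M D -> (a + b < 4)%nat -> forall t, continuous (fun z => D a b x z) t.
Proof.
  intros HD Hab. apply (smooth_continuous_x M _ b a x (smooth_transpose M D HD)); lia.
Qed.

Lemma smooth_taylor_x M D x y s :
  smooth M D ->
  Rabs (D 0%nat 0%nat (x + s) y
        - (D 0%nat 0%nat x y + D 1%nat 0%nat x y * s + D 2%nat 0%nat x y / 2 * s ^ 2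
           + D 3%nat 0%nat x y / 6 * s ^ 3))
    <= M * s ^ 4 / 24.
Proof.
  intros HD.
  assert (H := taylor_bound (fun k t => D k 0%nat t y) 3 M x s).
  replace (Rabs s ^ 4) with (s ^ 4) in H by (rewrite RPow_abs, Rabs_pos_eq; [reflexivity | nra]).
  eapply Rle_trans; [eapply Rle_trans; [|apply H]|].
  - right. f_equal. simpl. field.
  - intros k t Hk. apply (smooth_x M D HD k 0); lia.
  - intros t. apply (smooth_bound M D HD); lia.
  - right. simpl. field.
Qed.

Lemma second_diff_smooth_x M D a b x y d :
  smooth M D -> (1 <= 2 + a + b <= 4)%nat ->
  Rabs (second_diff (fun z => D a b z y) x d) <= M * d ^ 2.
Proof.
  intros HD Hab.
  apply (second_diff_bound (fun k z => D (k + a)%nat b z y)).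
  - intros k t Hk. apply (smooth_x M D HD (k + a) b); lia.
  - intros t. apply (smooth_bound M D HD); lia.
Qed.

Lemma second_diff_smooth_y M D a b x y d :
  smooth M D -> (1 <= 2 + a + b <= 4)%nat ->
  Rabs (second_diff (D a b x) y d) <= M * d ^ 2.
Proof.
  intros HD Hab. apply (second_diff_smooth_x M _ b a y x d (smooth_transpose M D HD)); lia.
Qed.

Lemma simpson_le (g : R -> R) (c h E : R) :
  (forall t, Rabs (g t) <= E) -> Rabs (simpson g c h) <= E.
Proof.
  intros HE. unfold simpson.
  assert (H1 := HE (c - h)). assert (H2 := HE c). assert (H3 := HE (c + h)). abs_lra.
Qed.

Lemma is_derive_simpson (F dF : R -> R -> R) (c h x : R) :
  (forall y, is_derive (fun z => F z y) x (dF x y)) ->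
  is_derive (fun z => simpson (F z) c h) x (simpson (dF x) c h).
Proof.
  intros HF. unfold simpson.
  apply (is_derive_scal (fun z => F z (c - h) + 4 * F z c + F z (c + h))).
  apply (is_derive_plus (fun z => F z (c - h) + 4 * F z c) (fun z => F z (c + h)));
    [|apply HF].
  apply (is_derive_plus (fun z => F z (c - h)) (fun z => 4 * F z c)); [apply HF|].
  apply is_derive_scal, HF.
Qed.

Lemma mean_simpson_order4 (G : nat -> R -> R) (c h N : R)
    (HG : forall k t, (k <= 3)%nat -> is_derive (G k) t (G (S k) t))
    (HN : forall t, Rabs (G 4%nat t) <= N) (Hh : 0 < h) :
  Rabs (mean (G 0%nat) c h - simpson (G 0%nat) c h) <= N * h ^ 4 / 12.
Proof.
  assert (HN0 : 0 <= N) by (eapply Rle_trans; [apply Rabs_pos | apply (HN 0)]).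
  replace (N * h ^ 4 / 12) with (2 * (N * h ^ 4 / 24)) by field.
  apply mean_simpson_bound with (a0 := G 0%nat c) (a1 := G 1%nat c)
    (a2 := G 2%nat c / 2) (a3 := G 3%nat c / 6); [exact Hh | |].
  - intros t. apply (ex_derive_continuous (V := R_NormedModule)).
    eexists. apply HG; lia.
  - intros s Hs. assert (H := taylor_bound G 3 N c s HG HN).
    eapply Rle_trans; [eapply Rle_trans; [|apply H]|].
    + right. f_equal. simpl. field.
    + replace (INR (fact 4)) with 24 by (simpl; ring).
      assert (Rabs s ^ 4 <= h ^ 4)
        by (apply pow_incr; split; [apply Rabs_pos | apply Rabs_le; lra]).
      unfold Rdiv. apply Rmult_le_compat_r; [lra|].
      apply Rmult_le_compat_l; assumption.
Qed.

(** For the case where two of the four available derivatives are already spent on a second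
    difference in the other variable. Only an affine Taylor polynomial remains, hence the zero
    coefficients [a2] and [a3]. *)
Lemma mean_simpson_order2 (G : nat -> R -> R) (c h N : R)
    (HG : forall k t, (k <= 1)%nat -> is_derive (G k) t (G (S k) t))
    (HN : forall t, Rabs (G 2%nat t) <= N) (Hh : 0 < h) :
  Rabs (mean (G 0%nat) c h - simpson (G 0%nat) c h) <= N * h ^ 2.
Proof.
  assert (HN0 : 0 <= N) by (eapply Rle_trans; [apply Rabs_pos | apply (HN 0)]).
  replace (N * h ^ 2) with (2 * (N * h ^ 2 / 2)) by field.
  apply mean_simpson_bound with (a0 := G 0%nat c) (a1 := G 1%nat c)
    (a2 := 0) (a3 := 0); [exact Hh | |].
  - intros t. apply (ex_derive_continuous (V := R_NormedModule)).
    eexists. apply HG; lia.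
  - intros s Hs. assert (H := taylor_bound G 1 N c s HG HN).
    eapply Rle_trans; [eapply Rle_trans; [|apply H]|].
    + right. f_equal. simpl. field.
    + replace (INR (fact 2)) with 2 by (simpl; ring).
      assert (Rabs s ^ 2 <= h ^ 2)
        by (apply pow_incr; split; [apply Rabs_pos | apply Rabs_le; lra]).
      unfold Rdiv. apply Rmult_le_compat_r; [lra|].
      apply Rmult_le_compat_l; assumption.
Qed.

Lemma is_derive_second_diff (F dF : R -> R -> R) (c d x : R) :
  (forall y, is_derive (fun z => F z y) x (dF x y)) ->
  is_derive (fun z => second_diff (F z) c d) x (second_diff (dF x) c d).
Proof.
  intros HF. unfold second_diff.
  apply (is_derive_minus (fun z => F z (c + d) + F z (c - d)) (fun z => 2 * F z c)).
  - apply (is_derive_plus (fun z => F z (c + d)) (fun z => F z (c - d))); apply HF.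
  - apply is_derive_scal, HF.
Qed.

(** * The product Simpson rule *)

Section ProductSimpson.

Variables (M : R) (D : nat -> nat -> R -> R -> R) (h k : R).
Hypotheses (HD : smooth M D) (Hh : 0 < h) (Hk : 0 < k).

Let f := D 0%nat 0%nat.

Let mean2 X Y := mean (fun x => mean (f x) Y k) X h.
Let simpson2 X Y := simpson (fun x => simpson (f x) Y k) X h.

(* The product Simpson error splits as [(I_x - S_x) S_y + I_x (I_y - S_y)]. *)
Let err_x X Y :=
  mean (fun x => simpson (f x) Y k) X h - simpson (fun x => simpson (f x) Y k) X h.
Let gap Y x := mean (f x) Y k - simpson (f x) Y k.
Let err_y X Y := mean (gap Y) X h.

Lemma smooth_bound_nonneg : 0 <= M.
Proof.
  eapply Rle_trans; [apply Rabs_pos | apply (smooth_bound M D HD 1 0 0 0); lia].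
Qed.

Lemma continuous_fy x : forall t, continuous (f x) t.
Proof. apply (smooth_continuous_y M D 0 0); [exact HD | lia]. Qed.

Lemma continuous_simpson_y Y : forall t, continuous (fun x => simpson (f x) Y k) t.
Proof.
  intros t. apply (ex_derive_continuous (V := R_NormedModule)). eexists.
  apply (is_derive_simpson f (D 1%nat 0%nat)). intros y.
  apply (smooth_x M D HD 0 0); lia.
Qed.

(** The bound [M] on the first x-derivative makes the mean Lipschitz in x, which gives continuity
    without differentiating under the integral. *)
Lemma continuous_mean_y Y : forall t, continuous (fun x => mean (f x) Y k) t.
Proof.
  apply (lipschitz_continuous _ M). intros s t.
  rewrite <- mean_minus by apply continuous_fy.
  apply mean_le; [exact Hk | |].
  - intros y. apply (continuous_minus (f s) (f t)); apply continuous_fy.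
  - intros y.
    assert (H := taylor_bound (fun n z => D n 0%nat z y) 0 M t (s - t)).
    replace (t + (s - t)) with s in H by ring. simpl in H.
    eapply Rle_trans; [eapply Rle_trans; [|apply H]|].
    + right. f_equal. unfold f. field.
    + intros n z Hn. apply (smooth_x M D HD n 0); lia.
    + intros z. apply (smooth_bound M D HD); lia.
    + right. field.
Qed.

Lemma continuous_gap Y : forall t, continuous (gap Y) t.
Proof.
  intros t. apply (continuous_minus (fun x => mean (f x) Y k) (fun x => simpson (f x) Y k)).
  - apply continuous_mean_y.
  - apply continuous_simpson_y.
Qed.

Lemma mean2_simpson2 X Y : mean2 X Y - simpson2 X Y = err_x X Y + err_y X Y.
Proof.
  unfold err_y, gap. rewrite mean_minus.
  - unfold mean2, simpson2, err_x. ring.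
  - apply continuous_mean_y.
  - apply continuous_simpson_y.
Qed.

(** Simpson's weights are positive with sum 1, so the Simpson sums in y of the x-derivatives form a
    derivative chain in x with the same bound [M]. *)
Lemma err_x_bound X Y : Rabs (err_x X Y) <= M * h ^ 4 / 12.
Proof.
  apply (mean_simpson_order4 (fun n x => simpson (D n 0%nat x) Y k)); [| |exact Hh].
  - intros n t Hn. apply (is_derive_simpson (D n 0%nat) (D (S n) 0%nat)).
    intros y. apply (smooth_x M D HD n 0); lia.
  - intros t. apply simpson_le. intros y. apply (smooth_bound M D HD); lia.
Qed.

Lemma err_y_bound X Y : Rabs (err_y X Y) <= M * k ^ 4 / 12.
Proof.
  apply mean_le; [exact Hh | apply continuous_gap |]. intros x.
  apply (mean_simpson_order4 (fun n => D 0%nat n x)); [| |exact Hk].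
  - intros n t Hn. apply (smooth_y M D HD 0 n); lia.
  - intros t. apply (smooth_bound M D HD); lia.
Qed.

(** The second difference in y commutes with the error functional in x. It takes two y-derivatives
    and yields [d^2]; the two x-derivatives left yield [h^2]. *)
Lemma err_x_second_diff X Y d :
  Rabs (second_diff (fun Y => err_x X Y) Y d) <= M * d ^ 2 * h ^ 2.
Proof.
  set (F := fun n x => simpson (fun y => second_diff (D n 0%nat x) y d) Y k).
  assert (E : second_diff (fun Y => err_x X Y) Y d
              = mean (F 0%nat) X h - simpson (F 0%nat) X h).
  { assert (EF : forall x, F 0%nat x = second_diff (fun Y => simpson (f x) Y k) Y d).
    { intros x. unfold F, simpson, second_diff, f.
      replace (Y - k + d) with (Y + d - k) by ring.
      replace (Y - k - d) with (Y - d - k) by ring.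
      replace (Y + k + d) with (Y + d + k) by ring.
      replace (Y + k - d) with (Y - d + k) by ring. ring. }
    assert (Es : simpson (F 0%nat) X h
      = second_diff (fun Y => simpson (fun x => simpson (f x) Y k) X h) Y d).
    { unfold simpson at 1. rewrite !EF. unfold second_diff, simpson. ring. }
    assert (Em : mean (F 0%nat) X h
      = second_diff (fun Y => mean (fun x => simpson (f x) Y k) X h) Y d).
    { unfold second_diff.
      transitivity (mean (fun x => (simpson (f x) (Y + d) k - simpson (f x) Y k)
                       - (simpson (f x) Y k - simpson (f x) (Y - d) k)) X h).
      - unfold mean. f_equal. apply RInt_ext. intros x _.
        rewrite EF. unfold second_diff.
        match goal with |- ?l = ?r => change (l = r :> R) end. ring.
      - assert (C := continuous_simpson_y).
        rewrite mean_minus.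
        + rewrite !mean_minus by apply C. ring.
        + intros t. apply (continuous_minus (fun x => simpson (f x) (Y + d) k)); apply C.
        + intros t. apply (continuous_minus (fun x => simpson (f x) Y k)); apply C. }
    rewrite Es, Em. unfold err_x, second_diff. ring. }
  rewrite E. apply mean_simpson_order2; [| |exact Hh].
  - intros n t Hn. unfold F.
    apply (is_derive_simpson (fun x y => second_diff (D n 0%nat x) y d)
                             (fun x y => second_diff (D (S n) 0%nat x) y d)).
    intros y. apply (is_derive_second_diff (D n 0%nat) (D (S n) 0%nat)).
    intros z. apply (smooth_x M D HD n 0); lia.
  - intros t. apply simpson_le. intros y.
    apply second_diff_smooth_y; [exact HD | lia].
Qed.

Lemma err_y_second_diff X Y d :
  Rabs (second_diff (fun X => err_y X Y) X d) <= M * d ^ 2 * k ^ 2.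
Proof.
  unfold err_y. rewrite mean_second_diff by apply continuous_gap.
  assert (Cg := continuous_gap Y).
  apply mean_le; [exact Hh | |].
  { intros t. unfold second_diff.
    apply (continuous_minus (fun t => gap Y (t + d) + gap Y (t - d)) (fun t => 2 * gap Y t)).
    - apply (continuous_plus (fun t => gap Y (t + d)) (fun t => gap Y (t - d))).
      + apply (continuous_translate (gap Y) d); exact Cg.
      + apply (continuous_translate (gap Y) (- d)); exact Cg.
    - apply (continuous_scal_r 2 (gap Y)), Cg. }
  intros x.
  set (F := fun n y => second_diff (fun x => D 0%nat n x y) x d).
  assert (E : second_diff (gap Y) x d = mean (F 0%nat) Y k - simpson (F 0%nat) Y k).
  { assert (Em : mean (F 0%nat) Y k = second_diff (fun x => mean (f x) Y k) x d).
    { unfold second_diff.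
      transitivity (mean (fun y => (f (x + d) y - f x y) - (f x y - f (x - d) y)) Y k).
      - unfold mean. f_equal. apply RInt_ext. intros y _. unfold F, second_diff, f.
        match goal with |- ?l = ?r => change (l = r :> R) end. ring.
      - assert (C := continuous_fy).
        rewrite mean_minus.
        + rewrite !mean_minus by apply C. ring.
        + intros t. apply (continuous_minus (f (x + d)) (f x)); apply C.
        + intros t. apply (continuous_minus (f x) (f (x - d))); apply C. }
    rewrite Em. unfold gap, F, simpson, second_diff, f. ring. }
  rewrite E. apply mean_simpson_order2; [| |exact Hk].
  - intros n t Hn. unfold F.
    apply (is_derive_second_diff (fun y x => D 0%nat n x y) (fun y x => D 0%nat (S n) x y)).
    intros z. apply (smooth_y M D HD 0 n); lia.
  - intros t. apply second_diff_smooth_x; [exact HD | lia].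
Qed.

Lemma product_simpson_error X Y :
  Rabs (mean2 X Y - simpson2 X Y) <= M * (h ^ 4 + k ^ 4) / 12.
Proof.
  rewrite mean2_simpson2.
  assert (H1 := err_x_bound X Y). assert (H2 := err_y_bound X Y). abs_lra.
Qed.

(** The [err_x] part is already of order [h^4], so its three values are bounded separately, with
    total weight 4. Only [err_y], of order [k^4], has to gain from the differencing in x. *)
Lemma product_simpson_error_second_diff_x X Y d :
  Rabs (second_diff (fun X => mean2 X Y - simpson2 X Y) X d)
    <= M * (h ^ 4 / 3 + d ^ 2 * k ^ 2).
Proof.
  assert (H := err_y_second_diff X Y d).
  unfold second_diff in *. rewrite !mean2_simpson2.
  assert (H1 := err_x_bound (X + d) Y). assert (H2 := err_x_bound (X - d) Y).
  assert (H3 := err_x_bound X Y). abs_lra.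
Qed.

Lemma product_simpson_error_second_diff_y X Y d :
  Rabs (second_diff (fun Y => mean2 X Y - simpson2 X Y) Y d)
    <= M * (k ^ 4 / 3 + d ^ 2 * h ^ 2).
Proof.
  assert (H := err_x_second_diff X Y d).
  unfold second_diff in *. rewrite !mean2_simpson2.
  assert (H1 := err_y_bound X (Y + d)). assert (H2 := err_y_bound X (Y - d)).
  assert (H3 := err_y_bound X Y). abs_lra.
Qed.

End ProductSimpson.

(** The stencils estimated with this expansion cancel the constant, linear and cubic terms, so only
    the quadratic coefficient is named. *)
Lemma smooth_taylor_row M D x y :
  smooth M D ->
  exists c0 c1 c3, forall z,
  Rabs (D 0%nat 0%nat z y
        - (c0 + c1 * (z - x) + D 2%nat 0%nat x y / 2 * (z - x) ^ 2 + c3 * (z - x) ^ 3))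
    <= M * (z - x) ^ 4 / 24.
Proof.
  intros HD. exists (D 0%nat 0%nat x y), (D 1%nat 0%nat x y), (D 3%nat 0%nat x y / 6).
  intros z. assert (H := smooth_taylor_x M D x y (z - x) HD).
  replace (x + (z - x)) with z in H by ring. exact H.
Qed.

(** * Grid functions sampled from a smooth function *)

Definition center_error (m : mesh) (D : nat -> nat -> R -> R -> R) (a : gridfun)
    (i j : Z) : R :=
  center a i j - D 0%nat 0%nat (xc m i) (yc m j).

(** The last two fields say that second differences of the center error carry a factor [dx^2] or
    [dy^2], so that they can be divided by it on meshes of any aspect ratio. *)
Record approx (m : mesh) (M : R) (D : nat -> nat -> R -> R -> R) (a : gridfun) : Prop := {
  approx_point : forall l i j, is_point l ->
    a l i j = D 0%nat 0%nat (xloc m l i) (yloc m l j);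
  approx_center : forall i j,
    Rabs (center_error m D a i j) <= M * (dx m ^ 4 + dy m ^ 4);
  approx_center_x : forall i j,
    Rabs (center_error m D a (i + 1) j + center_error m D a (i - 1) j
          - 2 * center_error m D a i j) <= M * dx m ^ 2 * (dx m ^ 2 + dy m ^ 2);
  approx_center_y : forall i j,
    Rabs (center_error m D a i (j + 1) + center_error m D a i (j - 1)
          - 2 * center_error m D a i j) <= M * dy m ^ 2 * (dx m ^ 2 + dy m ^ 2)
}.

Ltac mesh_eq :=
  unfold xh, xc, yh, yc; rewrite ?plus_IZR, ?minus_IZR; simpl; field.

Lemma approx_of_cell_average (m : mesh) (M : R) (D : nat -> nat -> R -> R -> R)
    (a : gridfun) :
  smooth M D ->
  (forall l i j, is_point l -> a l i j = D 0%nat 0%nat (xloc m l i) (yloc m l j)) ->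
  (forall i j, a Cell i j = cell_average m (D 0%nat 0%nat) i j) ->
  approx m M D a.
Proof.
  intros HD Hp Ha.
  assert (Hx := dx_pos m). assert (Hy := dy_pos m).
  assert (HM := smooth_bound_nonneg M D HD).
  set (f := D 0%nat 0%nat). set (h := dx m / 2). set (k := dy m / 2).
  assert (Hh : 0 < h) by (unfold h; lra). assert (Hk : 0 < k) by (unfold k; lra).
  set (err := fun X Y => mean (fun x => mean (f x) Y k) X h
                         - simpson (fun x => simpson (f x) Y k) X h).
  (* The center formula is the product Simpson rule solved for its middle value, whose weight is
     16/36; the center error is therefore the quadrature error times 36/16. *)
  assert (E : forall i j, center_error m D a i j = 36 / 16 * err (xc m i) (yc m j)).
  { intros i j. unfold center_error, center.
    rewrite Ha, !Hp by discriminate. simpl. unfold err, cell_average.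
    replace (xh m (i - 1)) with (xc m i - h) by (unfold h; mesh_eq).
    replace (xh m i) with (xc m i + h) by (unfold h; mesh_eq).
    replace (yh m (j - 1)) with (yc m j - k) by (unfold k; mesh_eq).
    replace (yh m j) with (yc m j + k) by (unfold k; mesh_eq).
    set (J := fun x => RInt (f x) (yc m j - k) (yc m j + k)).
    change (RInt _ (xc m i - h) (xc m i + h)) with (RInt J (xc m i - h) (xc m i + h)).
    assert (CJ : forall t, continuous J t).
    { intros t. apply (continuous_ext (fun x => (2 * k) * mean (f x) (yc m j) k)).
      - intros x. unfold mean, J.
        match goal with |- ?l = ?r => change (l = r :> R) end. field. lra.
      - apply (continuous_scal_r (2 * k) (fun x => mean (f x) (yc m j) k)).
        apply (continuous_mean_y M D k HD Hk). }
    assert (Em : mean (fun x => mean (f x) (yc m j) k) (xc m i) h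
                 = / (2 * h) * (/ (2 * k) * RInt J (xc m i - h) (xc m i + h))).
    { unfold mean at 1. f_equal.
      apply (RInt_scal J (xc m i - h) (xc m i + h) (/ (2 * k))).
      apply ex_RInt_cont, CJ. }
    rewrite Em. unfold simpson, f, h, k. field. lra. }
  assert (Xp : forall i, xc m (i + 1) = xc m i + dx m) by (intros; mesh_eq).
  assert (Xm : forall i, xc m (i - 1) = xc m i - dx m) by (intros; mesh_eq).
  assert (Yp : forall i, yc m (i + 1) = yc m i + dy m) by (intros; mesh_eq).
  assert (Ym : forall i, yc m (i - 1) = yc m i - dy m) by (intros; mesh_eq).
  assert (P1 : 0 <= M * dx m ^ 4) by (apply Rmult_le_pos; [|apply pow_le]; lra).
  assert (P2 : 0 <= M * dy m ^ 4) by (apply Rmult_le_pos; [|apply pow_le]; lra).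
  assert (P3 : 0 <= M * (dx m ^ 2 * dy m ^ 2))
    by (repeat apply Rmult_le_pos; try apply pow_le; lra).
  split; [exact Hp | | |]; intros i j.
  - rewrite E. assert (H := product_simpson_error M D h k HD Hh Hk (xc m i) (yc m j)).
    fold f in H. change (Rabs (err (xc m i) (yc m j)) <= M * (h ^ 4 + k ^ 4) / 12) in H.
    generalize dependent (err (xc m i) (yc m j)). unfold h, k. intros. abs_lra.
  - rewrite !E, Xp, Xm.
    assert (H := product_simpson_error_second_diff_x M D h k HD Hh Hk
                   (xc m i) (yc m j) (dx m)).
    change (Rabs (err (xc m i + dx m) (yc m j) + err (xc m i - dx m) (yc m j)
                  - 2 * err (xc m i) (yc m j))
            <= M * (h ^ 4 / 3 + dx m ^ 2 * k ^ 2)) in H.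
    generalize dependent (err (xc m i) (yc m j)).
    generalize (err (xc m i + dx m) (yc m j)) (err (xc m i - dx m) (yc m j)).
    unfold h, k. intros. abs_lra.
  - rewrite !E, Yp, Ym.
    assert (H := product_simpson_error_second_diff_y M D h k HD Hh Hk
                   (xc m i) (yc m j) (dy m)).
    change (Rabs (err (xc m i) (yc m j + dy m) + err (xc m i) (yc m j - dy m)
                  - 2 * err (xc m i) (yc m j))
            <= M * (k ^ 4 / 3 + dy m ^ 2 * h ^ 2)) in H.
    generalize dependent (err (xc m i) (yc m j)).
    generalize (err (xc m i) (yc m j + dy m)) (err (xc m i) (yc m j - dy m)).
    unfold h, k. intros. abs_lra.
Qed.

(** * Exchanging the roles of x and y *)

Definition transpose_mesh (m : mesh) : mesh :=
  Mesh (y0 m) (x0 m) (dy m) (dx m) (dy_pos m) (dx_pos m).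

Definition transpose_loc (l : loc) : loc :=
  match l with Cell => Cell | FaceX => FaceY | FaceY => FaceX | Corner => Corner end.

Definition transpose (a : gridfun) : gridfun := fun l i j => a (transpose_loc l) j i.

Lemma center_transpose a i j : center (transpose a) i j = center a j i.
Proof. unfold center, transpose; simpl. ring. Qed.

Lemma approx_transpose m M D a :
  approx m M D a ->
  approx (transpose_mesh m) M (fun a b x y => D b a y x) (transpose a).
Proof.
  intros [Hp Hc Hx Hy].
  assert (E : forall i j, center_error (transpose_mesh m) (fun a b x y => D b a y x)
                            (transpose a) i j = center_error m D a j i).
  { intros i j. unfold center_error. rewrite center_transpose. reflexivity. }
  split; intros; rewrite ?E.
  - unfold transpose. rewrite Hp by (intros e; destruct l; easy).
    destruct l; reflexivity.
  - simpl. rewrite Rplus_comm. apply Hc.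
  - simpl. rewrite (Rplus_comm (dy m ^ 2)). apply Hy.
  - simpl. rewrite (Rplus_comm (dy m ^ 2)). apply Hx.
Qed.

(** * Discrete gradients and dissipation *)

Definition grad_x (m : mesh) (a : gridfun) : gridfun := fun l i j =>
  match l with
  | Cell => / dx m * (flux_x a i j - flux_x a (i - 1) j)
  | Corner => / 2 * (Dx_plus m i (Half j) a + Dx_minus m i (Half j) a)
  | FaceX => / 2 * (Dx_plus m i (Whole j) a + Dx_minus m i (Whole j) a)
  | FaceY => Dx m i j a
  end.

(** Zero at cells and y-faces, where the scheme takes fluxes or central differences in x and no
    upwind ones. *)
Definition dissip_x (m : mesh) (a : gridfun) : gridfun := fun l i j =>
  match l with
  | Cell | FaceY => 0
  | Corner => / 2 * (Dx_plus m i (Half j) a - Dx_minus m i (Half j) a)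
  | FaceX => / 2 * (Dx_plus m i (Whole j) a - Dx_minus m i (Whole j) a)
  end.

Definition grad_y (m : mesh) (a : gridfun) : gridfun :=
  transpose (grad_x (transpose_mesh m) (transpose a)).
Definition dissip_y (m : mesh) (a : gridfun) : gridfun :=
  transpose (dissip_x (transpose_mesh m) (transpose a)).

Ltac expand_ops :=
  unfold transport, grad_y, dissip_y, transpose, grad_x, dissip_x, flux_x, flux_y,
    Dx_plus, Dx_minus, Dy_plus, Dy_minus, Dx, Dy, val, center, gadd, gsub; simpl.

Lemma transport_p m w l i j :
  transport m w Pvar l i j
  = - grad_x m (w Uvar) l i j - grad_y m (w Vvar) l i j
    - dissip_x m (w Pvar) l i j - dissip_y m (w Pvar) l i j.
Proof. destruct l; expand_ops; ring. Qed.

Lemma transport_u m w l i j :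
  transport m w Uvar l i j = - grad_x m (w Pvar) l i j - dissip_x m (w Uvar) l i j.
Proof. destruct l; expand_ops; ring. Qed.

Lemma transport_v m w l i j :
  transport m w Vvar l i j = - grad_y m (w Pvar) l i j - dissip_y m (w Vvar) l i j.
Proof. destruct l; expand_ops; ring. Qed.

Lemma Rabs_le_scaled (c x B : R) : 0 < c -> Rabs (c * x) <= c * B -> Rabs x <= B.
Proof.
  intros Hc H. rewrite Rabs_mult, (Rabs_pos_eq c) in H by lra.
  apply Rmult_le_reg_l with c; assumption.
Qed.

(* Replaces the value of the function at each node of a row by a fresh variable
   carrying its Taylor estimate about the abscissa [x]. *)
Ltac taylor_nodes HD x y :=
  let c0 := fresh "c" in let c1 := fresh "c" in let c3 := fresh "c" in
  let HT := fresh "HT" in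
  destruct (smooth_taylor_row _ _ x y HD) as [c0 [c1 [c3 HT]]];
  let A := fresh "A" in
  match type of HT with context [?D 2%nat 0%nat x y] => set (A := D 2%nat 0%nat x y) in * end;
  clearbody A;
  repeat match goal with
  | |- context [?D 0%nat 0%nat ?z y] =>
      let H := fresh "T" in
      assert (H := HT z);
      let v := fresh "v" in
      set (v := D 0%nat 0%nat z y) in *; clearbody v;
      unfold xh, xc in H; repeat rewrite ?plus_IZR, ?minus_IZR in H
  end;
  clear HT.

(** Up to the factor [1 / (2 dx)] this is the fourth difference with weights 1, -4, 6, -4, 1 on five
    nodes of spacing [dx / 2]. All of them carry point values on the row [y_(j+1/2)], so [dy] does
    not enter. *)
Lemma dissip_x_corner m M D a i j :
  smooth M D -> approx m M D a ->
  Rabs (dissip_x m a Corner i j) <= M * dx m ^ 3.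
Proof.
  intros HD Ha. assert (Hx := dx_pos m).
  assert (HM := smooth_bound_nonneg M D HD).
  assert (0 <= M * dx m ^ 4) by (apply Rmult_le_pos; [|apply pow_le]; lra).
  apply (Rabs_le_scaled (dx m)); [exact Hx|].
  unfold dissip_x, Dx_plus, Dx_minus, val.
  rewrite !(approx_point _ _ _ _ Ha) by discriminate. simpl xloc. simpl yloc.
  match goal with |- Rabs (?d * (/ 2 * (/ ?d * ?A - / ?d * ?B))) <= _ =>
    replace (d * (/ 2 * (/ d * A - / d * B))) with (/ 2 * (A - B)) by (field; lra)
  end.
  taylor_nodes HD (xh m i) (yh m j). abs_lra.
Qed.

(** The same fourth difference, but with two reconstructed center values. After multiplication by
    [dx] each has weight 2, so their errors contribute [4 M (dx^4 + dy^4)]; the Taylor remainders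
    fit in the fifth [M]. *)
Lemma dissip_x_face m M D a i j :
  smooth M D -> approx m M D a ->
  Rabs (dissip_x m a FaceX i j) <= 5 * M * (dx m ^ 4 + dy m ^ 4) / dx m.
Proof.
  intros HD Ha. assert (Hx := dx_pos m).
  assert (HM := smooth_bound_nonneg M D HD).
  assert (Hy := dy_pos m).
  assert (0 <= M * dx m ^ 4) by (apply Rmult_le_pos; [|apply pow_le]; lra).
  assert (0 <= M * dy m ^ 4) by (apply Rmult_le_pos; [|apply pow_le]; lra).
  apply (Rabs_le_scaled (dx m)); [exact Hx|].
  replace (dx m * (5 * M * (dx m ^ 4 + dy m ^ 4) / dx m))
    with (5 * M * (dx m ^ 4 + dy m ^ 4)) by (field; lra).
  assert (C1 := approx_center _ _ _ _ Ha i j).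
  assert (C2 := approx_center _ _ _ _ Ha (i + 1) j).
  unfold center_error in C1, C2.
  unfold dissip_x, Dx_plus, Dx_minus, val.
  set (c1 := center a i j) in *. set (c2 := center a (i + 1) j) in *.
  clearbody c1 c2.
  rewrite !(approx_point _ _ _ _ Ha) by discriminate. simpl xloc. simpl yloc.
  match goal with |- Rabs (?d * (/ 2 * (/ ?d * ?A - / ?d * ?B))) <= _ =>
    replace (d * (/ 2 * (/ d * A - / d * B))) with (/ 2 * (A - B)) by (field; lra)
  end.
  revert C1 C2. taylor_nodes HD (xh m i) (yc m j). intros C1 C2. abs_lra.
Qed.

Lemma center_split m D a i j :
  center a i j = D 0%nat 0%nat (xc m i) (yc m j) + center_error m D a i j.
Proof. unfold center_error. ring. Qed.

Lemma mesh_row_second_diff m M D a b x j :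
  smooth M D -> (1 <= 2 + a + b <= 4)%nat ->
  Rabs (D a b x (yh m j) + D a b x (yh m (j - 1)) - 2 * D a b x (yc m j))
    <= M * dy m ^ 2 / 4.
Proof.
  intros HD Hab.
  assert (H := second_diff_smooth_y M D a b x (yc m j) (dy m / 2) HD Hab).
  unfold second_diff in H.
  replace (yc m j + dy m / 2) with (yh m j) in H by mesh_eq.
  replace (yc m j - dy m / 2) with (yh m (j - 1)) in H by mesh_eq.
  abs_lra.
Qed.

(** Each composite stencil is symmetric in x about its location, so odd Taylor terms cancel. Center
    errors occur only as the second differences [E1] and [E2]. *)
Lemma grad_x_grad_x_error m M D a l i j :
  smooth M D -> approx m M D a ->
  Rabs (grad_x m (grad_x m a) l i j - D 2%nat 0%nat (xloc m l i) (yloc m l j))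
    <= 8 * M * (dx m ^ 2 + dy m ^ 2).
Proof.
  intros HD Ha. assert (Hx := dx_pos m). assert (Hy := dy_pos m).
  assert (HM := smooth_bound_nonneg M D HD).
  assert (0 <= M * dx m ^ 4) by (apply Rmult_le_pos; [|apply pow_le]; lra).
  assert (0 <= M * (dx m ^ 2 * dy m ^ 2))
    by (repeat apply Rmult_le_pos; try apply pow_le; lra).
  assert (E1 := approx_center_x _ _ _ _ Ha i j).
  assert (E2 := approx_center_x _ _ _ _ Ha (i + 1) j).
  rewrite Z.add_simpl_r in E2.
  assert (R1 := mesh_row_second_diff m M D 2 0 (xc m i) j HD ltac:(lia)).
  apply (Rabs_le_scaled (dx m ^ 2)); [nra|].
  destruct l; unfold xloc, yloc.
  (* At a cell the fluxes mix three rows with weights 1/6, 4/6, 1/6; [R1] compares the second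
     derivatives on these rows. *)
  - unfold grad_x, flux_x, Dx_plus, Dx_minus. simpl val.
    rewrite ?Z.sub_add, ?Z.add_simpl_r, !(center_split m D).
    rewrite !(approx_point _ _ _ _ Ha) by discriminate. simpl xloc. simpl yloc.
    set (e1 := center_error m D a i j) in *.
    set (e2 := center_error m D a (i + 1) j) in *.
    set (e3 := center_error m D a (i - 1) j) in *.
    clearbody e1 e2 e3. clear E2.
    apply (Rmult_le_compat_l (dx m ^ 2)) in R1; [|nra].
    rewrite <- (Rabs_pos_eq (dx m ^ 2)), <- Rabs_mult in R1 at 1 by nra.
    revert R1.
    taylor_nodes HD (xc m i) (yc m j).
    taylor_nodes HD (xc m i) (yh m j).
    taylor_nodes HD (xc m i) (yh m (j - 1)).
    intros R1.
    match goal with |- Rabs ?E <= _ => field_simplify E; [|lra] end.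
    abs_lra.
  (* At an x-face the center of [grad_x] involves the rows [y_(j-1/2)] and [y_(j+1/2)] too.
     Derivatives on each of them have weights 6 from the cell, -4 from the y-face and -1 from each
     of two corners; these sum to zero, so [R1] does not enter. *)
  - unfold grad_x at 1. unfold Dx_plus at 1, Dx_minus at 1. simpl val.
    unfold center, grad_x, flux_x, Dx_plus, Dx_minus, Dx. fold (center a). simpl val.
    rewrite ?Z.sub_add, ?Z.add_simpl_r, !(center_split m D).
    rewrite !(approx_point _ _ _ _ Ha) by discriminate. simpl xloc. simpl yloc.
    set (e1 := center_error m D a i j) in *.
    set (e2 := center_error m D a (i + 1) j) in *.
    set (e3 := center_error m D a (i - 1) j) in *.
    set (e4 := center_error m D a (i + 1 + 1) j) in *.
    clearbody e1 e2 e3 e4. clear R1.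
    taylor_nodes HD (xh m i) (yc m j).
    taylor_nodes HD (xh m i) (yh m j).
    taylor_nodes HD (xh m i) (yh m (j - 1)).
    match goal with |- Rabs ?E <= _ => field_simplify E; [|lra] end.
    abs_lra.
  (* At y-faces and corners the whole stencil consists of point values on one row. *)
  - clear E1 E2 R1. unfold grad_x, Dx, Dx_plus, Dx_minus. simpl val.
    rewrite ?Z.sub_add, ?Z.add_simpl_r.
    rewrite !(approx_point _ _ _ _ Ha) by discriminate. simpl xloc. simpl yloc.
    taylor_nodes HD (xc m i) (yh m j).
    match goal with |- Rabs ?E <= _ => field_simplify E; [|lra] end.
    abs_lra.
  - clear E1 E2 R1. unfold grad_x, Dx, Dx_plus, Dx_minus. simpl val.
    rewrite ?Z.sub_add, ?Z.add_simpl_r.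
    rewrite !(approx_point _ _ _ _ Ha) by discriminate. simpl xloc. simpl yloc.
    taylor_nodes HD (xh m i) (yh m j).
    match goal with |- Rabs ?E <= _ => field_simplify E; [|lra] end.
    abs_lra.
Qed.

Lemma grad_x_scal m (c : R) (a b : gridfun) l i j :
  (forall l i j, a l i j = c * b l i j) -> grad_x m a l i j = c * grad_x m b l i j.
Proof. intros H. destruct l; expand_ops; rewrite !H; ring. Qed.

Lemma dissip_x_scal m (c : R) (a b : gridfun) l i j :
  (forall l i j, a l i j = c * b l i j) -> dissip_x m a l i j = c * dissip_x m b l i j.
Proof. intros H. destruct l; expand_ops; rewrite ?H; ring. Qed.

Lemma grad_y_scal m (c : R) (a b : gridfun) l i j :
  (forall l i j, a l i j = c * b l i j) -> grad_y m a l i j = c * grad_y m b l i j.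
Proof. intros H. apply grad_x_scal. intros; apply H. Qed.

Lemma dissip_y_scal m (c : R) (a b : gridfun) l i j :
  (forall l i j, a l i j = c * b l i j) -> dissip_y m a l i j = c * dissip_y m b l i j.
Proof. intros H. apply dissip_x_scal. intros; apply H. Qed.

Lemma transpose_transpose_loc l : transpose_loc (transpose_loc l) = l.
Proof. destruct l; reflexivity. Qed.

Lemma dissip_y_transpose m a l i j :
  dissip_y (transpose_mesh m) (transpose a) (transpose_loc l) j i = dissip_x m a l i j.
Proof. destruct m, l; expand_ops; ring. Qed.

Lemma grad_y_grad_y m a l i j :
  grad_y m (grad_y m a) l i j
  = grad_x (transpose_mesh m) (grad_x (transpose_mesh m) (transpose a))
      (transpose_loc l) j i.
Proof.
  unfold grad_y at 1, transpose at 1. rewrite <- Rmult_1_l. apply grad_x_scal.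
  intros. unfold grad_y, transpose at 1 2. rewrite transpose_transpose_loc. ring.
Qed.

Lemma grad_y_grad_y_error m M D a l i j :
  smooth M D -> approx m M D a ->
  Rabs (grad_y m (grad_y m a) l i j - D 0%nat 2%nat (xloc m l i) (yloc m l j))
    <= 8 * M * (dx m ^ 2 + dy m ^ 2).
Proof.
  intros HD Ha. rewrite grad_y_grad_y.
  assert (H := grad_x_grad_x_error _ M _ _ (transpose_loc l) j i
                 (smooth_transpose M D HD) (approx_transpose m M D a Ha)).
  rewrite (Rplus_comm (dx m ^ 2)). destruct l; exact H.
Qed.

Lemma dissip_y_corner m M D a i j :
  smooth M D -> approx m M D a -> Rabs (dissip_y m a Corner i j) <= M * dy m ^ 3.
Proof.
  intros HD Ha. exact (dissip_x_corner _ M _ _ j i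
    (smooth_transpose M D HD) (approx_transpose m M D a Ha)).
Qed.

Lemma dissip_y_face m M D a i j :
  smooth M D -> approx m M D a ->
  Rabs (dissip_y m a FaceY i j) <= 5 * M * (dx m ^ 4 + dy m ^ 4) / dy m.
Proof.
  intros HD Ha. rewrite (Rplus_comm (dx m ^ 4)).
  exact (dissip_x_face _ M _ _ j i
    (smooth_transpose M D HD) (approx_transpose m M D a Ha)).
Qed.

(** * Time derivatives of the grid operators *)

Lemma is_derive_Rplus (f g : R -> R) t df dg :
  is_derive f t df -> is_derive g t dg -> is_derive (fun s => f s + g s) t (df + dg).
Proof. apply (is_derive_plus f g). Qed.

Lemma is_derive_Rminus (f g : R -> R) t df dg :
  is_derive f t df -> is_derive g t dg -> is_derive (fun s => f s - g s) t (df - dg).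
Proof. apply (is_derive_minus f g). Qed.

Lemma is_derive_Rmult_const (f : R -> R) t c df :
  is_derive f t df -> is_derive (fun s => c * f s) t (c * df).
Proof. apply is_derive_scal. Qed.

Ltac derive_linear :=
  repeat first [apply is_derive_Rminus | apply is_derive_Rplus | apply is_derive_Rmult_const].

Lemma is_derive_center (a : R -> gridfun) (d : gridfun) t i j :
  (forall l i j, is_derive (fun s => a s l i j) t (d l i j)) ->
  is_derive (fun s => center (a s) i j) t (center d i j).
Proof. intros H. unfold center. derive_linear; apply H. Qed.

Lemma is_derive_dissip_x_face m (a : R -> gridfun) (d : gridfun) t i j :
  (forall l i j, is_derive (fun s => a s l i j) t (d l i j)) ->
  is_derive (fun s => dissip_x m (a s) FaceX i j) t (dissip_x m d FaceX i j).
Proof.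
  intros H. assert (Hc := fun i j => is_derive_center a d t i j H).
  unfold dissip_x, Dx_plus, Dx_minus, val. derive_linear; apply H || apply Hc.
Qed.

Lemma transport_0 m w q l i j :
  (forall q l i j, w q l i j = 0) -> transport m w q l i j = 0.
Proof. intros H. destruct q, l; expand_ops; rewrite !H; ring. Qed.

(** * The lowest orders in eps *)

Section FormalSolution.

Variables (m : mesh) (sigma : R) (T : R -> Prop) (W : expansion).
Hypotheses (Hsigma : 0 < sigma) (HT : open T) (HW : formal_solution m sigma T W).

(** For negative powers of eps the coefficient on the left is the constant 0, so the right-hand side
    of [formal_solution] must vanish. *)
Lemma is_derive_0_unique (t c : R) : is_derive (fun _ : R => 0) t c -> c = 0.
Proof.
  intros H. rewrite <- (is_derive_unique _ _ _ H). apply Derive_const.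
Qed.

Lemma leading_velocity_0 t l i j :
  T t -> W 0%nat t Uvar l i j = 0 /\ W 0%nat t Vvar l i j = 0.
Proof.
  intros Ht.
  assert (Hu := is_derive_0_unique _ _ (HW (-2)%Z t Uvar l i j Ht)).
  assert (Hv := is_derive_0_unique _ _ (HW (-2)%Z t Vvar l i j Ht)).
  (* At order eps^-2 the transport term acts on the coefficient of eps^-1, which is zero. *)
  rewrite transport_0 in Hu, Hv by reflexivity.
  simpl in Hu, Hv.
  change (0 + - sigma * W 0%nat t Uvar l i j = 0) in Hu.
  change (0 + - sigma * W 0%nat t Vvar l i j = 0) in Hv.
  split; apply (Rmult_eq_reg_l (- sigma)); lra.
Qed.

Lemma first_velocity_u t l i j :
  T t -> W 1%nat t Uvar l i j = - / sigma * grad_x m (W 0%nat t Pvar) l i j.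
Proof.
  intros Ht.
  assert (H := is_derive_0_unique _ _ (HW (-1)%Z t Uvar l i j Ht)).
  change (transport m (W 0%nat t) Uvar l i j + - sigma * W 1%nat t Uvar l i j = 0) in H.
  (* Scaling by the factor 0 expresses that the dissipation of [u0 = 0] vanishes. *)
  rewrite transport_u, (dissip_x_scal m 0 _ (fun _ _ _ => 0)) in H
    by (intros; rewrite (proj1 (leading_velocity_0 t _ _ _ Ht)); ring).
  apply (Rmult_eq_reg_l sigma); [|lra]. field_simplify; lra.
Qed.

Lemma first_velocity_v t l i j :
  T t -> W 1%nat t Vvar l i j = - / sigma * grad_y m (W 0%nat t Pvar) l i j.
Proof.
  intros Ht.
  assert (H := is_derive_0_unique _ _ (HW (-1)%Z t Vvar l i j Ht)).
  change (transport m (W 0%nat t) Vvar l i j + - sigma * W 1%nat t Vvar l i j = 0) in H.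
  rewrite transport_v, (dissip_y_scal m 0 _ (fun _ _ _ => 0)) in H
    by (intros; rewrite (proj2 (leading_velocity_0 t _ _ _ Ht)); ring).
  apply (Rmult_eq_reg_l sigma); [|lra]. field_simplify; lra.
Qed.

Lemma leading_dissip_0 t l i j :
  T t -> dissip_x m (W 0%nat t Pvar) l i j + dissip_y m (W 0%nat t Pvar) l i j = 0.
Proof.
  intros Ht.
  assert (H := is_derive_0_unique _ _ (HW (-1)%Z t Pvar l i j Ht)).
  change (transport m (W 0%nat t) Pvar l i j + 0 = 0) in H.
  rewrite transport_p in H.
  rewrite (grad_x_scal m 0 _ (fun _ _ _ => 0)) in H
    by (intros; rewrite (proj1 (leading_velocity_0 t _ _ _ Ht)); ring).
  rewrite (grad_y_scal m 0 _ (fun _ _ _ => 0)) in H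
    by (intros; rewrite (proj2 (leading_velocity_0 t _ _ _ Ht)); ring).
  lra.
Qed.

Lemma is_derive_leading_p t l i j :
  T t -> is_derive (fun s => W 0%nat s Pvar l i j) t (transport m (W 1%nat t) Pvar l i j).
Proof.
  intros Ht. assert (H := HW 0%Z t Pvar l i j Ht).
  change (is_derive (fun s => W 0%nat s Pvar l i j) t
            (transport m (W 1%nat t) Pvar l i j + 0)) in H.
  rewrite Rplus_0_r in H. exact H.
Qed.

Let pdot t : gridfun := fun l i j => Derive (fun s => W 0%nat s Pvar l i j) t.

Lemma Derive_leading_p t l i j :
  T t ->
  pdot t l i j
  = - grad_x m (W 1%nat t Uvar) l i j - grad_y m (W 1%nat t Vvar) l i j
    - dissip_x m (W 1%nat t Pvar) l i j - dissip_y m (W 1%nat t Pvar) l i j.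
Proof.
  intros Ht. rewrite <- transport_p. apply is_derive_unique, is_derive_leading_p, Ht.
Qed.

(** On x-faces [dissip_y] is zero by definition, so the order eps^-1 of the p-equation gives
    [dissip_x p0 = 0] there. This holds throughout the open set [T] and can be differentiated in
    time. *)
Lemma dissip_x_Derive_leading_p t i j : T t -> dissip_x m (pdot t) FaceX i j = 0.
Proof.
  intros Ht. apply (is_derive_0_unique t).
  apply (is_derive_ext_loc (fun s => dissip_x m (W 0%nat s Pvar) FaceX i j)).
  - apply (filter_imp T); [|exact (HT t Ht)]. intros s Hs.
    assert (H := leading_dissip_0 s FaceX i j Hs).
    unfold dissip_y, transpose in H. simpl in H. simpl. lra.
  - apply is_derive_dissip_x_face. intros.
    apply Derive_correct. eexists. apply is_derive_leading_p, Ht.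
Qed.

Lemma dissip_y_Derive_leading_p t i j : T t -> dissip_y m (pdot t) FaceY i j = 0.
Proof.
  intros Ht. apply (is_derive_0_unique t).
  apply (is_derive_ext_loc (fun s => dissip_y m (W 0%nat s Pvar) FaceY i j)).
  - apply (filter_imp T); [|exact (HT t Ht)]. intros s Hs.
    assert (H := leading_dissip_0 s FaceY i j Hs).
    change (dissip_x m (W 0%nat s Pvar) FaceY i j) with 0 in H. lra.
  - unfold dissip_y. simpl.
    apply (is_derive_dissip_x_face (transpose_mesh m) (fun s => transpose (W 0%nat s Pvar))).
    intros. apply Derive_correct. eexists. apply is_derive_leading_p, Ht.
Qed.

(** The dissipation of [p1] stays on the left, since on faces it may be too large. What remains is
    the sum of the two composed-gradient errors, with 8 + 8 = 16. *)
Lemma leading_p_consistent t M D l i j :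
  T t -> smooth M D -> approx m M D (W 0%nat t Pvar) ->
  Rabs (pdot t l i j + dissip_x m (W 1%nat t Pvar) l i j
        + dissip_y m (W 1%nat t Pvar) l i j
        - (/ sigma * D 2%nat 0%nat (xloc m l i) (yloc m l j)
           + / sigma * D 0%nat 2%nat (xloc m l i) (yloc m l j)))
    <= 16 * M / sigma * (dx m ^ 2 + dy m ^ 2).
Proof.
  intros Ht HD Ha.
  rewrite (Derive_leading_p t l i j Ht).
  rewrite (grad_x_scal m (- / sigma) _ (grad_x m (W 0%nat t Pvar)))
    by (intros; apply first_velocity_u, Ht).
  rewrite (grad_y_scal m (- / sigma) _ (grad_y m (W 0%nat t Pvar)))
    by (intros; apply first_velocity_v, Ht).
  assert (Hx := grad_x_grad_x_error m M D _ l i j HD Ha).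
  assert (Hy := grad_y_grad_y_error m M D _ l i j HD Ha).
  apply (Rabs_le_scaled sigma); [exact Hsigma|].
  match goal with |- Rabs ?E <= ?F => field_simplify E; [field_simplify F|]; [|lra..] end.
  abs_lra.
Qed.

End FormalSolution.

(** With [s] the supremum of [|r_i|], the relation gives [8 |r_i| <= 4 E + 4 s], hence
    [s <= (E + s) / 2] and [s <= E]. The bound [B] ensures that the supremum is finite. *)
Lemma diagonally_dominant_bound (r : Z -> R) (B E : R) :
  (forall i, Rabs (r i) <= B) ->
  (forall i, Rabs (2 * r (i - 1)%Z + 8 * r i + 2 * r (i + 1)%Z) <= 4 * E) ->
  forall i, Rabs (r i) <= E.
Proof.
  intros HB HE.
  destruct (completeness (fun x => exists i, x = Rabs (r i))) as [s [Hub Hlub]].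
  - exists B. intros x [i ->]. apply HB.
  - exists (Rabs (r 0%Z)), 0%Z. reflexivity.
  - assert (Hs : forall i, Rabs (r i) <= s) by (intros i; apply Hub; exists i; reflexivity).
    assert (Hle : s <= (E + s) / 2).
    { apply Hlub. intros x [i ->].
      assert (H := HE i). assert (H1 := Hs (i - 1)%Z). assert (H2 := Hs (i + 1)%Z).
      abs_lra. }
    intros i. specialize (Hs i). lra.
Qed.

(** * Consistency with the heat equation *)

(* The vanishing dissipation is a tridiagonal system in i with diagonal 8 and
   off-diagonal entries 2; the a priori bound [B] does not enter the conclusion. *)
Lemma face_residual_bound (m : mesh) (G : R -> R -> R) (d : gridfun) (K E B : R) :
  (forall x y h, Rabs (second_diff (fun z => G z y) x h) <= K * h ^ 2) ->
  (forall x y h, Rabs (second_diff (G x) y h) <= K * h ^ 2) ->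
  K * (dx m ^ 2 + dy m ^ 2) <= E ->
  (forall l i j, l <> FaceX -> Rabs (d l i j - G (xloc m l i) (yloc m l j)) <= E) ->
  (forall i j, Rabs (d FaceX i j - G (xh m i) (yc m j)) <= B) ->
  (forall i j, dissip_x m d FaceX i j = 0) ->
  forall i j, Rabs (d FaceX i j - G (xh m i) (yc m j)) <= 12 * E.
Proof.
  intros Gx Gy HK HE HB H0 i j. revert i.
  assert (Hx := dx_pos m). assert (Hy := dy_pos m).
  assert (HK0 : 0 <= K).
  { assert (H := Gx 0 0 1). assert (H' := Rabs_pos (second_diff (fun z => G z 0) 0 1)). lra. }
  assert (KX : 0 <= K * dx m ^ 2) by (apply Rmult_le_pos; [|apply pow_le]; lra).
  assert (KY : 0 <= K * dy m ^ 2) by (apply Rmult_le_pos; [|apply pow_le]; lra).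
  apply (diagonally_dominant_bound (fun i => d FaceX i j - G (xh m i) (yc m j)) B);
    [intros i; apply HB|].
  intros i. cbv beta.
  (* The fourth difference has weights 1, 6, 1 on the x-faces. Each center, taken with factor -4,
     adds 1 to both adjacent x-faces, which gives 2, 8, 2. *)
  assert (D0 : 2 * d FaceX (i - 1)%Z j + 8 * d FaceX i j + 2 * d FaceX (i + 1)%Z j
    = 9 * (d Cell i j + d Cell (i + 1)%Z j)
      - (d FaceY i (j - 1)%Z + d FaceY i j
         + d FaceY (i + 1)%Z (j - 1)%Z + d FaceY (i + 1)%Z j)
      - / 4 * (d Corner (i - 1)%Z (j - 1)%Z + 2 * d Corner i (j - 1)%Z
               + d Corner (i + 1)%Z (j - 1)%Z + d Corner (i - 1)%Z j
               + 2 * d Corner i j + d Corner (i + 1)%Z j)).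
  { assert (H := H0 i j). unfold dissip_x, Dx_plus, Dx_minus in H. simpl val in H.
    unfold center in H. rewrite Z.add_simpl_r in H.
    apply (Rmult_eq_compat_l (2 * dx m)) in H. field_simplify in H; lra. }
  assert (Ry : forall x, Rabs (G x (yh m j) + G x (yh m (j - 1)) - 2 * G x (yc m j))
                         <= K * dy m ^ 2 / 4).
  { intros x. assert (H := Gy x (yc m j) (dy m / 2)). unfold second_diff in H.
    replace (yc m j + dy m / 2) with (yh m j) in H by mesh_eq.
    replace (yc m j - dy m / 2) with (yh m (j - 1)) in H by mesh_eq.
    abs_lra. }
  (* Both sides of [D0] have total weight 12, so [G] satisfies it up to second differences: in y at
     five abscissae, and in x along the row by [R6] and [R7]. *)
  assert (R1 := Ry (xh m (i - 1))). assert (R2 := Ry (xc m i)). assert (R3 := Ry (xh m i)).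
  assert (R4 := Ry (xc m (i + 1))). assert (R5 := Ry (xh m (i + 1))).
  assert (R6 := Gx (xh m i) (yc m j) (dx m / 2)).
  assert (R7 := Gx (xh m i) (yc m j) (dx m)).
  unfold second_diff in R6, R7.
  replace (xh m i + dx m / 2) with (xc m (i + 1)) in R6 by mesh_eq.
  replace (xh m i - dx m / 2) with (xc m i) in R6 by mesh_eq.
  replace (xh m i + dx m) with (xh m (i + 1)) in R7 by mesh_eq.
  replace (xh m i - dx m) with (xh m (i - 1)) in R7 by mesh_eq.
  assert (C1 := HE Cell i j ltac:(easy)).
  assert (C2 := HE Cell (i + 1)%Z j ltac:(easy)).
  assert (F1 := HE FaceY i (j - 1)%Z ltac:(easy)).
  assert (F2 := HE FaceY i j ltac:(easy)).
  assert (F3 := HE FaceY (i + 1)%Z (j - 1)%Z ltac:(easy)).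
  assert (F4 := HE FaceY (i + 1)%Z j ltac:(easy)).
  assert (Q1 := HE Corner (i - 1)%Z (j - 1)%Z ltac:(easy)).
  assert (Q2 := HE Corner i (j - 1)%Z ltac:(easy)).
  assert (Q3 := HE Corner (i + 1)%Z (j - 1)%Z ltac:(easy)).
  assert (Q4 := HE Corner (i - 1)%Z j ltac:(easy)).
  assert (Q5 := HE Corner i j ltac:(easy)).
  assert (Q6 := HE Corner (i + 1)%Z j ltac:(easy)).
  simpl in C1, C2, F1, F2, F3, F4, Q1, Q2, Q3, Q4, Q5, Q6.
  clear Gx Gy HE HB H0 Ry. abs_lra.
Qed.

Lemma pow4_div_le (a b : R) : 0 < a <= b -> (a ^ 4 + b ^ 4) / b <= 2 * b ^ 3.
Proof.
  intros [Ha Hb]. apply (Rmult_le_reg_r b); [lra|].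
  replace ((a ^ 4 + b ^ 4) / b * b) with (a ^ 4 + b ^ 4) by (field; lra).
  assert (a ^ 4 <= b ^ 4) by (apply pow_incr; lra). lra.
Qed.

Lemma pow3_le_pow2 (a : R) : 0 < a < 1 -> a ^ 3 <= a ^ 2.
Proof. intros Ha. assert (0 < a ^ 2) by (apply pow_lt; lra). simpl in *. nra. Qed.

(** Stated for general [G] and [d], so that it serves x-faces directly and y-faces on the transposed
    grid. *)
Lemma face_consistent (m : mesh) (G : R -> R -> R) (d p : gridfun) (D : nat -> nat -> R -> R -> R)
    (M K E : R) :
  dx m < 1 -> dy m < 1 ->
  (forall x y h, Rabs (second_diff (fun z => G z y) x h) <= K * h ^ 2) ->
  (forall x y h, Rabs (second_diff (G x) y h) <= K * h ^ 2) ->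
  smooth M D -> approx m M D p ->
  (forall l i j, Rabs (d l i j + dissip_x m p l i j + dissip_y m p l i j
                       - G (xloc m l i) (yloc m l j)) <= E * (dx m ^ 2 + dy m ^ 2)) ->
  (forall i j, dissip_x m d FaceX i j = 0) ->
  forall i j, Rabs (d FaceX i j - G (xh m i) (yc m j))
              <= 12 * (E + 10 * M + K) * (dx m ^ 2 + dy m ^ 2).
Proof.
  intros Hx1 Hy1 Gx Gy HD Hp HE H0 i j.
  assert (Hx := dx_pos m). assert (Hy := dy_pos m).
  assert (HM := smooth_bound_nonneg M D HD).
  assert (HK0 : 0 <= K).
  { assert (H := Gx 0 0 1). assert (H' := Rabs_pos (second_diff (fun z => G z 0) 0 1)). lra. }
  set (H2 := dx m ^ 2 + dy m ^ 2) in *.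
  assert (HH : 0 < H2) by (unfold H2; assert (0 < dx m ^ 2) by (apply pow_lt; lra);
                           assert (0 < dy m ^ 2) by (apply pow_lt; lra); lra).
  assert (HE0 : 0 <= E * H2).
  { eapply Rle_trans; [apply Rabs_pos | apply (HE Cell 0%Z 0%Z)]. }
  assert (KH : 0 <= K * H2) by (apply Rmult_le_pos; lra).
  assert (MH : 0 <= M * H2) by (apply Rmult_le_pos; lra).
  assert (Lx := pow3_le_pow2 (dx m) (conj Hx Hx1)).
  assert (Ly := pow3_le_pow2 (dy m) (conj Hy Hy1)).
  assert (Px : 0 < dx m ^ 3) by (apply pow_lt; lra).
  assert (Py : 0 < dy m ^ 3) by (apply pow_lt; lra).
  (* Valid on every mesh. For [dy <= dx] it already has the required order; for [dx < dy] it
     provides the a priori bound for the tridiagonal system. *)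
  assert (Fx : forall i j, Rabs (d FaceX i j - G (xh m i) (yc m j))
    <= E * H2 + 5 * M * (dx m ^ 4 + dy m ^ 4) / dx m).
  { intros i' j'. assert (A1 := HE FaceX i' j').
    assert (A2 := dissip_x_face m M D p i' j' HD Hp).
    change (dissip_y m p FaceX i' j') with 0 in A1.
    simpl xloc in A1; simpl yloc in A1. abs_lra. }
  destruct (Rle_or_lt (dy m) (dx m)) as [Hxy | Hxy].
  - eapply Rle_trans; [apply Fx|].
    assert (A := pow4_div_le (dy m) (dx m) (conj Hy Hxy)).
    assert (B : (dx m ^ 4 + dy m ^ 4) / dx m <= 2 * H2).
    { unfold H2. rewrite (Rplus_comm (dx m ^ 4)). lra. }
    apply (Rmult_le_compat_l (5 * M)) in B; [|lra].
    unfold Rdiv in *. rewrite Rmult_assoc. lra.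
  - rewrite Rmult_assoc.
    apply (face_residual_bound m G d K ((E + 10 * M + K) * H2)
             (E * H2 + 5 * M * (dx m ^ 4 + dy m ^ 4) / dx m) Gx Gy);
      [fold H2; lra | | exact Fx | exact H0].
    intros l i' j' Hl. assert (A1 := HE l i' j').
    destruct l; [| easy | |]; simpl xloc in *; simpl yloc in *.
    + change (dissip_x m p Cell i' j') with 0 in A1.
      change (dissip_y m p Cell i' j') with 0 in A1. abs_lra.
    + change (dissip_x m p FaceY i' j') with 0 in A1.
      assert (A2 := dissip_y_face m M D p i' j' HD Hp).
      assert (A := pow4_div_le (dx m) (dy m) ltac:(lra)).
      assert (B : (dx m ^ 4 + dy m ^ 4) / dy m <= 2 * H2) by (unfold H2; lra).
      apply (Rmult_le_compat_l (5 * M)) in B; [|lra].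
      unfold Rdiv in *. rewrite (Rmult_assoc (5 * M)) in A2. abs_lra.
    + assert (A2 := dissip_x_corner m M D p i' j' HD Hp).
      assert (A3 := dissip_y_corner m M D p i' j' HD Hp).
      assert (B : dx m ^ 3 + dy m ^ 3 <= H2) by (unfold H2; lra).
      apply (Rmult_le_compat_l M) in B; [|lra].
      abs_lra.
Qed.

(** Taylor expansion in x at height [y + s] leaves two remainders [M hx^3 / 6]. The y-dependence of
    [D 2 0] is then expanded to first order, and the mean kills its linear term. *)
Lemma edge_flux_error M D x y hx hy :
  smooth M D -> 0 < hx -> 0 < hy ->
  Rabs (/ (2 * hx) * (mean (D 1%nat 0%nat (x + hx)) y hy - mean (D 1%nat 0%nat (x - hx)) y hy)
        - D 2%nat 0%nat x y) <= M * (hx ^ 2 + hy ^ 2).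
Proof.
  intros HD Hx Hy. assert (HM := smooth_bound_nonneg M D HD).
  assert (P1 : 0 <= M * hx ^ 2) by (apply Rmult_le_pos; [|apply pow_le]; lra).
  assert (P2 : 0 <= M * hy ^ 2) by (apply Rmult_le_pos; [|apply pow_le]; lra).
  assert (P3 : 0 <= M * hx ^ 3) by (apply Rmult_le_pos; [|apply pow_le]; lra).
  assert (C := smooth_continuous_y M D 1 0).
  rewrite <- mean_minus by (apply C; [exact HD | lia]).
  assert (H : Rabs (mean (fun t => D 1%nat 0%nat (x + hx) t - D 1%nat 0%nat (x - hx) t) y hy
                    - (2 * hx * D 2%nat 0%nat x y + 0 * hy ^ 2 / 3))
              <= M * hx ^ 3 / 3 + 2 * hx * (M * hy ^ 2 / 2)).
  { apply mean_bound with (a1 := 2 * hx * D 2%nat 1%nat x y) (a3 := 0); [exact Hy | |].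
    - intros t. apply (continuous_minus (D 1%nat 0%nat (x + hx)) (D 1%nat 0%nat (x - hx)));
        apply C; auto with arith; lia.
    - intros s Hs.
      assert (T := fun s' => taylor_bound (fun n z => D (S n) 0%nat z (y + s)) 2 M x s').
      assert (T1 := T hx). assert (T2 := T (- hx)). clear T.
      assert (T3 := taylor_bound (fun n => D 2%nat n x) 1 M y s).
      rewrite Rabs_Ropp in T2. rewrite (Rabs_pos_eq hx) in T1, T2 by lra.
      rewrite pow2_abs in T3.
      specialize (T1 ltac:(intros; apply (smooth_x M D HD); lia)
                     ltac:(intros; apply (smooth_bound M D HD); lia)).
      specialize (T2 ltac:(intros; apply (smooth_x M D HD); lia)
                     ltac:(intros; apply (smooth_bound M D HD); lia)).
      specialize (T3 ltac:(intros; apply (smooth_y M D HD); lia)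
                     ltac:(intros; apply (smooth_bound M D HD); lia)).
      replace (INR (fact 3)) with 6 in T1, T2 by (simpl; ring).
      replace (INR (fact 2)) with 2 in T3 by (simpl; ring).
      simpl sum_f_R0 in T1, T2, T3. simpl INR in T1, T2, T3.
      unfold Rdiv in T1, T2, T3. rewrite !Rinv_1 in T1, T2, T3.
      replace (x - hx) with (x + - hx) by ring.
      assert (S2 : s ^ 2 <= hy ^ 2) by nra.
      apply (Rmult_le_compat_l M) in S2; [|lra].
      assert (T3' : Rabs (hx * D 2%nat 0%nat x (y + s)
                          - hx * (D 2%nat 0%nat x y + s * D 2%nat 1%nat x y))
                    <= hx * (M * hy ^ 2 * / 2)).
      { rewrite <- Rmult_minus_distr_l, Rabs_mult, (Rabs_pos_eq hx) by lra.
        apply Rmult_le_compat_l; [lra|]. abs_lra. }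
      clear T3. abs_lra. }
  apply (Rabs_le_scaled (2 * hx)); [lra|].
  match goal with |- Rabs (_ * (_ * ?m - _)) <= _ => set (I := m) in * end.
  replace (2 * hx * (/ (2 * hx) * I - D 2%nat 0%nat x y))
    with (I - (2 * hx * D 2%nat 0%nat x y + 0 * hy ^ 2 / 3)) by (field; lra).
  eapply Rle_trans; [exact H|].
  replace (2 * hx * (M * (hx ^ 2 + hy ^ 2)))
    with (2 * (M * hx ^ 3) + 2 * (hx * (M * hy ^ 2))) by ring.
  assert (0 <= hx * (M * hy ^ 2)) by (apply Rmult_le_pos; lra). lra.
Qed.

Lemma heat_rhs_cell_error sigma m M (f : R -> R -> R) i j :
  0 < sigma -> smooth M (fun a b => partial_derive a b f) ->
  Rabs (heat_rhs_cell sigma m f i j - heat_rhs sigma f (xc m i) (yc m j))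
    <= M / sigma * (dx m ^ 2 + dy m ^ 2).
Proof.
  intros Hs HD. assert (Hx := dx_pos m). assert (Hy := dy_pos m).
  assert (HM := smooth_bound_nonneg M _ HD).
  assert (P1 : 0 <= M * dx m ^ 2) by (apply Rmult_le_pos; [|apply pow_le]; lra).
  assert (P2 : 0 <= M * dy m ^ 2) by (apply Rmult_le_pos; [|apply pow_le]; lra).
  assert (Ex := edge_flux_error M _ (xc m i) (yc m j) (dx m / 2) (dy m / 2) HD
                  ltac:(lra) ltac:(lra)).
  assert (Ey := edge_flux_error M _ (yc m j) (xc m i) (dy m / 2) (dx m / 2)
                  (smooth_transpose _ _ HD) ltac:(lra) ltac:(lra)).
  cbv beta in Ex, Ey. unfold mean in Ex, Ey.
  replace (xc m i + dx m / 2) with (xh m i) in Ex, Ey by mesh_eq.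
  replace (xc m i - dx m / 2) with (xh m (i - 1)) in Ex, Ey by mesh_eq.
  replace (yc m j + dy m / 2) with (yh m j) in Ex, Ey by mesh_eq.
  replace (yc m j - dy m / 2) with (yh m (j - 1)) in Ex, Ey by mesh_eq.
  replace (2 * (dx m / 2)) with (dx m) in Ex, Ey by field.
  replace (2 * (dy m / 2)) with (dy m) in Ex, Ey by field.
  set (Fx := fun x => / dy m *
    RInt (fun y => partial_derive 1 0 f x y) (yh m (j - 1)) (yh m j)).
  set (Fy := fun y => / dx m *
    RInt (fun x => partial_derive 0 1 f x y) (xh m (i - 1)) (xh m i)).
  change (Rabs (/ dx m * (Fx (xh m i) - Fx (xh m (i - 1)))
                - partial_derive 2 0 f (xc m i) (yc m j))
          <= M * ((dx m / 2) ^ 2 + (dy m / 2) ^ 2)) in Ex.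
  change (Rabs (/ dy m * (Fy (yh m j) - Fy (yh m (j - 1)))
                - partial_derive 0 2 f (xc m i) (yc m j))
          <= M * ((dy m / 2) ^ 2 + (dx m / 2) ^ 2)) in Ey.
  apply (Rabs_le_scaled sigma); [exact Hs|].
  change (heat_rhs_cell sigma m f i j)
    with (/ (sigma * dx m) * (Fx (xh m i) - Fx (xh m (i - 1)))
          + / (sigma * dy m) * (Fy (yh m j) - Fy (yh m (j - 1)))).
  unfold heat_rhs. clearbody Fx Fy.
  match type of Ex with Rabs (?A - ?B) <= _ =>
  match type of Ey with Rabs (?A' - ?B') <= _ =>
    match goal with |- Rabs ?E <= _ =>
      replace E with (A - B + (A' - B')) by (field; lra) end end end.
  replace (sigma * (M / sigma * (dx m ^ 2 + dy m ^ 2)))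
    with (M * (dx m ^ 2 + dy m ^ 2)) by (field; lra).
  abs_lra.
Qed.

(** [heat_rhs] takes two of the four bounded derivatives and the second difference the other two. *)
Lemma heat_rhs_second_diff_x sigma M f x y h :
  0 < sigma -> smooth M (fun a b => partial_derive a b f) ->
  Rabs (second_diff (fun z => heat_rhs sigma f z y) x h) <= 2 * M / sigma * h ^ 2.
Proof.
  intros Hs HD.
  assert (H1 := second_diff_smooth_x M _ 2 0 x y h HD ltac:(lia)).
  assert (H2 := second_diff_smooth_x M _ 0 2 x y h HD ltac:(lia)).
  apply (Rabs_le_scaled sigma); [exact Hs|].
  unfold second_diff, heat_rhs in *.
  match goal with |- Rabs ?E <= ?F => field_simplify E; [field_simplify F|]; [|lra..] end.
  abs_lra.
Qed.

Lemma heat_rhs_second_diff_y sigma M f x y h :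
  0 < sigma -> smooth M (fun a b => partial_derive a b f) ->
  Rabs (second_diff (heat_rhs sigma f x) y h) <= 2 * M / sigma * h ^ 2.
Proof.
  intros Hs HD.
  assert (H1 := second_diff_smooth_y M _ 2 0 x y h HD ltac:(lia)).
  assert (H2 := second_diff_smooth_y M _ 0 2 x y h HD ltac:(lia)).
  apply (Rabs_le_scaled sigma); [exact Hs|].
  unfold second_diff, heat_rhs in *.
  match goal with |- Rabs ?E <= ?F => field_simplify E; [field_simplify F|]; [|lra..] end.
  abs_lra.
Qed.

(** * From the regularity assumption to the theorem *)

Lemma regular_approx m M T W pf k t :
  regular m M T W pf -> (k <= 1)%nat -> T t ->
  smooth M (fun a b => partial_derive a b (pf k t)) /\
  approx m M (fun a b => partial_derive a b (pf k t)) (W k t Pvar).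
Proof.
  intros Hr Hk Ht. destruct (Hr k t Hk Ht) as [Hd [Hb [Ha Hp]]].
  assert (HD := smooth_partial_derive M (pf k t) Hd Hb).
  split; [exact HD|]. apply approx_of_cell_average; assumption.
Qed.

Lemma pow4_div_le_mul (a b kappa : R) :
  0 < a -> 0 < b -> b <= kappa * a -> (a ^ 4 + b ^ 4) / a <= (1 + kappa ^ 4) * a ^ 3.
Proof.
  intros Ha Hb Hab. apply (Rmult_le_reg_r a); [lra|].
  replace ((a ^ 4 + b ^ 4) / a * a) with (a ^ 4 + b ^ 4) by (field; lra).
  assert (H : b ^ 4 <= (kappa * a) ^ 4) by (apply pow_incr; lra).
  rewrite Rpow_mult_distr in H. lra.
Qed.

Theorem proposition7p1 (sigma : R) (hsigma : 0 < sigma) :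
  (* relations (1)-(3) *)
  (forall (m : mesh) (T : R -> Prop) (W : expansion),
     open T -> formal_solution m sigma T W ->
     forall (t : R) (i j : Z), T t ->
     let p0 := W 0%nat t Pvar in
     let u1 := W 1%nat t Uvar in
     let v1 := W 1%nat t Vvar in
     (forall l : loc, W 0%nat t Uvar l i j = 0 /\ W 0%nat t Vvar l i j = 0) /\
     (u1 Cell i j = - / (sigma * dx m) * (flux_x p0 i j - flux_x p0 (i - 1) j) /\
      v1 Cell i j = - / (sigma * dy m) * (flux_y p0 i j - flux_y p0 i (j - 1)) /\
      u1 Corner i j
        = - / (2 * sigma) * (Dx_plus m i (Half j) p0 + Dx_minus m i (Half j) p0) /\
      v1 Corner i j
        = - / (2 * sigma) * (Dy_plus m (Half i) j p0 + Dy_minus m (Half i) j p0) /\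
      u1 FaceX i j
        = - / (2 * sigma) * (Dx_plus m i (Whole j) p0 + Dx_minus m i (Whole j) p0) /\
      v1 FaceX i j = - / sigma * Dy m i j p0 /\
      u1 FaceY i j = - / sigma * Dx m i j p0 /\
      v1 FaceY i j
        = - / (2 * sigma) * (Dy_plus m (Whole i) j p0 + Dy_minus m (Whole i) j p0)) /\
     is_derive (fun s => W 0%nat s Pvar Cell i j) t
       (- / dx m * (flux_x u1 i j - flux_x u1 (i - 1) j)
        - / dy m * (flux_y v1 i j - flux_y v1 i (j - 1))))
  /\
  (* relation (4) *)
  bigO sigma any_mesh (fun hx hy => hx ^ 3 + hy ^ 3)
    (fun m W pf t i j =>
       let u1 := W 1%nat t Uvar in
       let v1 := W 1%nat t Vvar in
       Derive (fun s => W 0%nat s Pvar Corner i j) t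
       - (- / 2 * (Dx_plus m i (Half j) u1 + Dx_minus m i (Half j) u1)
          - / 2 * (Dy_plus m (Half i) j v1 + Dy_minus m (Half i) j v1)))
  /\
  (forall kappa : R,
   bigO sigma (dy_le kappa) (fun hx hy => hx ^ 3)
    (fun m W pf t i j =>
       let u1 := W 1%nat t Uvar in
       let v1 := W 1%nat t Vvar in
       Derive (fun s => W 0%nat s Pvar FaceX i j) t
       - (- / 2 * (Dx_plus m i (Whole j) u1 + Dx_minus m i (Whole j) u1)
          - Dy m i j v1)))
  /\
  (forall kappa : R,
   bigO sigma (dx_le kappa) (fun hx hy => hy ^ 3)
    (fun m W pf t i j =>
       let u1 := W 1%nat t Uvar in
       let v1 := W 1%nat t Vvar in
       Derive (fun s => W 0%nat s Pvar FaceY i j) t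
       - (- Dx m i j u1
          - / 2 * (Dy_plus m (Whole i) j v1 + Dy_minus m (Whole i) j v1))))
  /\
  (* consistency with the heat equation *)
  bigO sigma any_mesh (fun hx hy => hx ^ 2 + hy ^ 2)
    (fun m W pf t i j =>
       Derive (fun s => W 0%nat s Pvar Cell i j) t
       - heat_rhs_cell sigma m (pf 0%nat t) i j)
  /\
  (forall l : loc, is_point l ->
   bigO sigma any_mesh (fun hx hy => hx ^ 2 + hy ^ 2)
    (fun m W pf t i j =>
       Derive (fun s => W 0%nat s Pvar l i j) t
       - heat_rhs sigma (pf 0%nat t) (xloc m l i) (yloc m l j))).

Proof.
  split; [|split; [|split; [|split; [|split]]]].
  - intros m T W HT HW t i j Ht p0 u1 v1.
    assert (Hx := dx_pos m). assert (Hy := dy_pos m).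
    assert (Hu := first_velocity_u m sigma T W hsigma HW t).
    assert (Hv := first_velocity_v m sigma T W hsigma HW t).
    split; [intros l; apply (leading_velocity_0 m sigma T); assumption|].
    split.
    + unfold u1, v1. rewrite !Hu, !Hv by exact Ht. fold p0. clearbody p0.
      expand_ops. repeat split; field; lra.
    + assert (H := is_derive_leading_p m sigma T W HW t Cell i j Ht). exact H.
  - intros M. exists M, 1. split; [lra|].
    intros m T W pf Hx1 Hy1 _ HT HW Hr t i j Ht. cbv beta zeta.
    destruct (regular_approx m M T W pf 1 t Hr ltac:(lia) Ht) as [HD Ha].
    assert (H := Derive_leading_p m sigma T W HW t Corner i j Ht).
    cbv beta in H. rewrite H.
    assert (A1 := dissip_x_corner m M _ _ i j HD Ha).
    assert (A2 := dissip_y_corner m M _ _ i j HD Ha).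
    (* The claimed right-hand side omits exactly the dissipation of [p1]; on faces only its part in
       the upwind direction is nonzero. *)
    match goal with |- Rabs ?E <= _ =>
      replace E with (- dissip_x m (W 1%nat t Pvar) Corner i j
                      - dissip_y m (W 1%nat t Pvar) Corner i j)
        by (expand_ops; ring) end.
    abs_lra.
  - intros kappa M. exists (5 * M * (1 + kappa ^ 4)), 1. split; [lra|].
    intros m T W pf Hx1 Hy1 Hxy HT HW Hr t i j Ht. cbv beta zeta.
    destruct (regular_approx m M T W pf 1 t Hr ltac:(lia) Ht) as [HD Ha].
    assert (HM := smooth_bound_nonneg M _ HD).
    assert (H := Derive_leading_p m sigma T W HW t FaceX i j Ht).
    cbv beta in H. rewrite H.
    assert (A1 := dissip_x_face m M _ _ i j HD Ha).
    match goal with |- Rabs ?E <= _ =>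
      replace E with (- dissip_x m (W 1%nat t Pvar) FaceX i j)
        by (expand_ops; ring) end.
    rewrite Rabs_Ropp. eapply Rle_trans; [exact A1|].
    assert (B := pow4_div_le_mul (dx m) (dy m) kappa (dx_pos m) (dy_pos m) Hxy).
    apply (Rmult_le_compat_l (5 * M)) in B; [|lra].
    unfold Rdiv in *. rewrite !Rmult_assoc in *. exact B.
  - intros kappa M. exists (5 * M * (1 + kappa ^ 4)), 1. split; [lra|].
    intros m T W pf Hx1 Hy1 Hxy HT HW Hr t i j Ht. cbv beta zeta.
    destruct (regular_approx m M T W pf 1 t Hr ltac:(lia) Ht) as [HD Ha].
    assert (HM := smooth_bound_nonneg M _ HD).
    assert (H := Derive_leading_p m sigma T W HW t FaceY i j Ht).
    cbv beta in H. rewrite H.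
    assert (A1 := dissip_y_face m M _ _ i j HD Ha).
    match goal with |- Rabs ?E <= _ =>
      replace E with (- dissip_y m (W 1%nat t Pvar) FaceY i j)
        by (expand_ops; ring) end.
    rewrite Rabs_Ropp. eapply Rle_trans; [exact A1|].
    assert (B := pow4_div_le_mul (dy m) (dx m) kappa (dy_pos m) (dx_pos m) Hxy).
    rewrite (Rplus_comm (dy m ^ 4)) in B.
    apply (Rmult_le_compat_l (5 * M)) in B; [|lra].
    unfold Rdiv in *. rewrite !Rmult_assoc in *. exact B.
  (* 16 comes from [leading_p_consistent] at the cell center, 1 from replacing the center value of
     [heat_rhs] by its cell average. *)
  - intros M. exists (17 * M / sigma), 1. split; [lra|].
    intros m T W pf _ _ _ HT HW Hr t i j Ht.
    destruct (regular_approx m M T W pf 0 t Hr ltac:(lia) Ht) as [HD Ha].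
    assert (H1 := leading_p_consistent m sigma T W hsigma HW t M _ Cell i j Ht HD Ha).
    assert (H2 := heat_rhs_cell_error sigma m M (pf 0%nat t) i j hsigma HD).
    change (dissip_x _ _ Cell i j) with 0 in H1. change (dissip_y _ _ Cell i j) with 0 in H1.
    cbv beta in H1. unfold heat_rhs in H2. simpl xloc in H1. simpl yloc in H1.
    abs_lra.
  - intros l Hl M.
    (* [16 M / sigma] is the consistency error, [10 M] bounds the dissipation of [p1] where it is
       under control, [2 M / sigma] bounds second differences of [heat_rhs], and 12 comes from
       [face_residual_bound]. Corners fit in the same constant. *)
    exists (12 * (16 * M / sigma + 10 * M + 2 * M / sigma)), 1. split; [lra|].
    intros m T W pf Hx1 Hy1 _ HT HW Hr t i j Ht.
    destruct (regular_approx m M T W pf 0 t Hr ltac:(lia) Ht) as [HD Ha].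
    destruct (regular_approx m M T W pf 1 t Hr ltac:(lia) Ht) as [HD1 Ha1].
    set (d := (fun l i j => Derive (fun s => W 0%nat s Pvar l i j) t) : gridfun).
    change (Rabs (d l i j - heat_rhs sigma (pf 0%nat t) (xloc m l i) (yloc m l j))
            <= 12 * (16 * M / sigma + 10 * M + 2 * M / sigma) * (dx m ^ 2 + dy m ^ 2)).
    assert (HC := fun l i j =>
      leading_p_consistent m sigma T W hsigma HW t M _ l i j Ht HD Ha).
    destruct l; [easy | | |].
    + apply (face_consistent m _ d (W 1%nat t Pvar) _ M _ _ Hx1 Hy1) with (2 := fun x y h =>
        heat_rhs_second_diff_y sigma M (pf 0%nat t) x y h hsigma HD) (3 := HD1).
      * intros. apply heat_rhs_second_diff_x; assumption.
      * exact Ha1.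
      * exact HC.
      * intros. apply (dissip_x_Derive_leading_p m sigma T W hsigma HT HW t); assumption.
    + rewrite (Rplus_comm (dx m ^ 2)).
      apply (face_consistent (transpose_mesh m) (fun x y => heat_rhs sigma (pf 0%nat t) y x)
               (transpose d) (transpose (W 1%nat t Pvar)) _ M _ _ Hy1 Hx1)
        with (3 := smooth_transpose _ _ HD1) (4 := approx_transpose _ _ _ _ Ha1).
      * intros. apply heat_rhs_second_diff_y; assumption.
      * intros. apply (heat_rhs_second_diff_x sigma M (pf 0%nat t)); assumption.
      (* Transposition exchanges the two dissipations, so the sum has to be reordered. *)
      * intros l' i' j'. specialize (HC (transpose_loc l') j' i').
        rewrite <- (dissip_y_transpose m), transpose_transpose_loc in HC.
        rewrite (Rplus_comm (dx m ^ 2)) in HC.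
        change (dissip_y m (W 1%nat t Pvar) (transpose_loc l') j' i') with
          (dissip_x (transpose_mesh m) (transpose (W 1%nat t Pvar))
             (transpose_loc (transpose_loc l')) i' j') in HC.
        rewrite transpose_transpose_loc in HC.
        rewrite (Rplus_assoc (transpose d l' i' j')), (Rplus_comm (dissip_x _ _ _ _ _)),
          <- Rplus_assoc.
        destruct l'; exact HC.
      * intros i' j'.
        exact (dissip_y_Derive_leading_p m sigma T W hsigma HT HW t j' i' Ht).
    + assert (H := HC Corner i j).
      change (Rabs (d Corner i j + dissip_x m (W 1%nat t Pvar) Corner i j
                    + dissip_y m (W 1%nat t Pvar) Corner i j
                    - heat_rhs sigma (pf 0%nat t) (xloc m Corner i) (yloc m Corner j))
              <= 16 * M / sigma * (dx m ^ 2 + dy m ^ 2)) in H.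
      assert (A1 := dissip_x_corner m M _ _ i j HD1 Ha1).
      assert (A2 := dissip_y_corner m M _ _ i j HD1 Ha1).
      assert (Lx := pow3_le_pow2 (dx m) (conj (dx_pos m) Hx1)).
      assert (Ly := pow3_le_pow2 (dy m) (conj (dy_pos m) Hy1)).
      assert (HM := smooth_bound_nonneg M _ HD).
      assert (B : M * (dx m ^ 3 + dy m ^ 3) <= M * (dx m ^ 2 + dy m ^ 2))
        by (apply Rmult_le_compat_l; lra).
      assert (HH : 0 <= dx m ^ 2 + dy m ^ 2) by nra.
      assert (P1 : 0 <= M * (dx m ^ 2 + dy m ^ 2)) by (apply Rmult_le_pos; assumption).
      assert (P2 : 0 <= / sigma * (M * (dx m ^ 2 + dy m ^ 2))).
      { apply Rmult_le_pos; [|exact P1]. left. apply Rinv_0_lt_compat, hsigma. }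
      clear HC. abs_lra.
Qed.
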